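(* Assume the non-lattice case. The measure $\rho$ on $C$ given by $$\rho(dx)=\left(\int_{[0,\infty)}\mu\bigl((x,x+y]\bigr)\,\mu(dy)\right)dx$$ is an invariant measure for the process of reflections $(R_k)$. It is the unique invariant Radon measure of $(R_k)$ up to multiplication with constants, if the measure $\nu$ is the unique invariant Radon measure of the reflected random walk $(X_n)$ up to multiplication with constants.
   Context: Let $(Y_n)_{n\ge 1}$ be i.i.d. non-constant, non-negative real random variables with common distribution $\mu$ and distribution function $F_\mu(x)=\mu([0,x])$. Non-lattice case: there is no $\kappa>0$ with $\operatorname{supp}(\mu)\subset\kappa\cdot\mathbb{N}_0$, where $\mathbb{N}_0=\{0,1,2,\dots\}$. Let $N=\sup\operatorname{supp}(\mu)$, and $C=[0,N]$ if $N<\infty$, $C=[0,\infty)$ if $N=\infty$. Reflected random walk is the Markov chain given by $X_0\ge0$ and $X_{n+1}=|X_n-Y_{n+1}|$; it is considered on $C$, which is absorbing. Reflection times: $r(0)=0$ and $r(k+1)=\inf\{n>r(k): X_n=-(X_{n-1}-Y_n)\}=\inf\{n>r(k): Y_{r(k)+1}+\dots+Y_n\ge X_{r(k)}\}$; these are almost surely finite. The process of reflections is the Markov chain $R_k=X_{r(k)}$ on $C$. The measure $\nu$ on $C$ is $\nu(dx)=\bigl(1-F_\mu(x)\bigr)\,dx$, where $dx$ is Lebesgue measure; it is known to be invariant for $(X_n)$. Invariant measures are understood to be non-zero. *)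

(* Defs.v *)
From HB Require Import structures.
From mathcomp Require Import all_boot all_order all_algebra.
From mathcomp Require Import finmap.
From mathcomp Require Import all_classical all_reals all_analysis.
From mathcomp Require Import measurable_realfun.

Set Implicit Arguments.
Unset Strict Implicit.
Unset Printing Implicit Defensive.
Import Order.TTheory GRing.Theory Num.Theory.
Import numFieldNormedType.Exports.

Local Open Scope classical_set_scope.
Local Open Scope ring_scope.

Section random_variables.
Context d (T : measurableType d) (R : realType) (P : probability T R).

Definition mutually_independent (I : choiceType) (Y : I -> {RV P >-> R}) :=
  forall (J : {fset I}) (A : I -> set R), (forall i, measurable (A i)) ->
    P (\bigcap_(i in [set` J]) Y i @^-1` A i) =
    (\prod_(i <- J) P (Y i @^-1` A i))%E.

Definition identically_distributed (I : Type) (Y : I -> {RV P >-> R})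
    (mu : probability (measurableTypeR R) R) :=
  forall i A, measurable A -> distribution P (Y i) A = mu A.

End random_variables.

Section law.
Context (R : realType) (mu : probability (measurableTypeR R) R).

(* topological support *)
Definition supp : set R :=
  [set x | forall U : set R, open U -> U x -> (0 < mu U)%E].

Definition non_lattice :=
  ~ exists2 kappa : R, 0 < kappa & supp `<=` [set kappa * n%:R | n in [set: nat]].

Definition cumul (x : R) : \bar R := mu `[0, x]%classic.

Definition supN : \bar R := ereal_sup (EFin @` supp).

(* [0, N] if N is finite, [0, +oo[ otherwise *)
Definition state_space : set R := [set x | 0 <= x /\ (x%:E <= supN)%E].

(* Measures on the state space are represented by the measures on R whose
   complement of the state space is null. *)
Definition nu (A : set (measurableTypeR R)) : \bar R :=
  (\int[lebesgue_measure]_(x in A `&` state_space) (1 - cumul x))%E.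

Definition rho (A : set (measurableTypeR R)) : \bar R :=
  (\int[lebesgue_measure]_(x in A `&` state_space)
     \int[mu]_(y in `[0%R, +oo[) mu `]x, (x + y)%R]%classic)%E.

Lemma measurable_state_space : measurable (state_space : set (measurableTypeR R)).
Proof.
have -> : state_space = `[0, +oo[%classic `&` [set x | (x%:E <= supN)%E].
  apply/seteqP; split => x /=; rewrite in_itv/= andbT; by case.
apply: measurableI; first exact: measurable_itv.
case: supN => [r| |].
- have -> : [set x | (x%:E <= r%:E)%E] = `]-oo, r]%classic.
    by apply/seteqP; split => x /=; rewrite in_itv/= lee_fin.
  exact: measurable_itv.
- have -> : [set x : R | (x%:E <= +oo)%E] = setT.
    by apply/seteqP; split => x //= _; rewrite leey.
  exact: measurableT.
- have -> : [set x : R | (x%:E <= -oo)%E] = set0.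
    by apply/seteqP; split => x //=.
  exact: measurable0.
Qed.

Lemma nu_density_ge0 x : (0 <= 1 - cumul x)%E.
Proof.
by rewrite sube_ge0 ?orbT//; apply: probability_le1; exact: measurable_itv.
Qed.

Lemma measurable_nu_density (D : set (measurableTypeR R)) : measurable D ->
  measurable_fun D (fun x => (1 - cumul x)%E : \bar R).
Proof.
move=> mD; apply: (@measurable_funS _ _ _ _ setT) => //.
apply: emeasurable_funB => //.
have -> : cumul = EFin \o (fun x => fine (cumul x)).
  apply/funext => x /=; rewrite fineK//.
  by apply: fin_num_measure; exact: measurable_itv.
apply/measurable_EFinP; apply: nondecreasing_measurable => //.
move=> x y xy; apply: fine_le; try (apply: fin_num_measure; exact: measurable_itv).
apply: le_measure; rewrite ?inE; try exact: measurable_itv.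
by apply: subset_itvl; rewrite bnd_simp.
Qed.

Lemma rho_density_ge0 x : (0 <= \int[mu]_(y in `[0%R, +oo[) mu `]x, (x + y)%R]%classic)%E.
Proof. by apply: integral_ge0. Qed.

Lemma measurable_rho_density (D : set (measurableTypeR R)) : measurable D ->
  measurable_fun D
    (fun x => \int[mu]_(y in `[0%R, +oo[) mu `]x, (x + y)%R]%classic)%E.
Proof.
move=> mD; apply: (@measurable_funS _ _ _ _ setT) => //.
pose G (x : R) := mu `]-oo, x]%classic.
have fG x : G x \is a fin_num by apply: fin_num_measure; exact: measurable_itv.
have ndG : {homo (fine \o G) : x y / x <= y}.
  move=> x y xy; apply: fine_le => //.
  apply: le_measure; rewrite ?inE; try exact: measurable_itv.
  by apply: subset_itvl; rewrite bnd_simp.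
have mG : measurable_fun setT (fine \o G) by exact: nondecreasing_measurable.
pose h (p : measurableTypeR R * measurableTypeR R) : \bar R :=
  (Num.max 0 (fine (G (p.1 + p.2)) - fine (G p.1)))%:E.
have hE x y : 0 <= y -> mu `]x, x + y]%classic = h (x, y).
  move=> y0; have xy : x <= x + y by rewrite lerDl.
  have E : G (x + y) = (G x + mu `]x, (x + y)%R]%classic)%E.
    rewrite /G -measureU; try exact: measurable_itv.
      by rewrite -itv_bndbnd_setU// bnd_simp.
    by apply/seteqP; split => z //=; rewrite !in_itv/= => -[zx /andP[+ _]]; rewrite ltNge zx.
  have fm : mu `]x, x + y]%classic \is a fin_num.
    by apply: fin_num_measure; exact: measurable_itv.
  rewrite /h /= E fineD// addrAC subrr add0r -{1}(fineK fm); congr (_%:E).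
  by apply/esym/max_idPr; exact: fine_ge0.
have mh : measurable_fun setT h.
  apply/measurable_EFinP; apply: measurable_maxr => //.
  apply: measurable_funB.
    by apply: (measurableT_comp mG); exact: measurable_funD.
  exact: (measurableT_comp mG).
have -> : (fun x => \int[mu]_(y in `[0%R, +oo[) mu `]x, (x + y)%R]%classic)%E =
    (fun x => \int[mu]_y ((h \_ (setT `*` `[0%R, +oo[)) (x, y)))%E.
  apply/funext => x; rewrite integral_mkcond; apply: eq_integral => y _.
  rewrite /patch; have [yI|yI] := boolP (y \in `[0, +oo[%classic); last first.
    by rewrite ifF//; apply/negbTE; apply: contra yI; rewrite !inE => -[].
  rewrite ifT; last by move: yI; rewrite !inE.
  by apply: hE; move: yI; rewrite inE/= in_itv/= andbT.
apply: (@measurable_fun_fubini_tonelli_F _ _ _ _ _ mu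
  (h \_ (setT `*` `[0%R, +oo[))); last first.
  by move=> p; rewrite /patch; case: ifP => // _; rewrite lee_fin le_max lexx.
apply/(measurable_restrictT _ _).1.
  by apply: measurableX => //; exact: measurable_itv.
exact: measurable_funS mh.
Qed.

End law.

Section measures.
Context (R : realType) (mu : probability (measurableTypeR R) R).

Let nu0 : nu mu set0 = 0%E.
Proof. by rewrite /nu set0I integral_set0. Qed.

Let nu_ge0 A : (0 <= nu mu A)%E.
Proof. by apply: integral_ge0 => x _; exact: nu_density_ge0. Qed.

Let nu_sigma_additive : semi_sigma_additive (nu mu).
Proof.
move=> F mF tF mUF; rewrite /nu setI_bigcupl ge0_integral_bigcup//.
- by apply: is_cvg_ereal_nneg_natsum_cond => n _ _; exact: nu_ge0.
- by move=> n; apply: measurableI => //; exact: measurable_state_space.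
- by apply: measurable_nu_density; apply: bigcup_measurable => n _;
    apply: measurableI => //; exact: measurable_state_space.
- by move=> x _; exact: nu_density_ge0.
- exact: trivIset_setIr.
Qed.

HB.instance Definition _ := isMeasure.Build _ _ _ (nu mu)
  nu0 nu_ge0 nu_sigma_additive.

Let rho0 : rho mu set0 = 0%E.
Proof. by rewrite /rho set0I integral_set0. Qed.

Let rho_ge0 A : (0 <= rho mu A)%E.
Proof. by apply: integral_ge0 => x _; exact: rho_density_ge0. Qed.

Let rho_sigma_additive : semi_sigma_additive (rho mu).
Proof.
move=> F mF tF mUF; rewrite /rho setI_bigcupl ge0_integral_bigcup//.
- by apply: is_cvg_ereal_nneg_natsum_cond => n _ _; exact: rho_ge0.
- by move=> n; apply: measurableI => //; exact: measurable_state_space.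
- by apply: measurable_rho_density; apply: bigcup_measurable => n _;
    apply: measurableI => //; exact: measurable_state_space.
- by move=> x _; exact: rho_density_ge0.
- exact: trivIset_setIr.
Qed.

HB.instance Definition _ := isMeasure.Build _ _ _ (rho mu)
  rho0 rho_ge0 rho_sigma_additive.

End measures.

(* Pathwise definitions: y is a realization of (Y_n), of which only the terms
   of index n >= 1 are used, and x is the starting point. *)
Section paths.
Context (R : realType) (y : nat -> R) (x : R).

Fixpoint reflected_walk (n : nat) : R :=
  if n is m.+1 then `|reflected_walk m - y m.+1| else x.

Definition is_reflection (n : nat) : bool :=
  reflected_walk n == - (reflected_walk n.-1 - y n).

(* None stands for the infimum of the empty set *)
Definition next_reflection (m : nat) : option nat :=
  if pselect (exists n, (m < n)%N && is_reflection n) is left e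
  then Some (ex_minn e) else None.

Fixpoint reflection_time (k : nat) : option nat :=
  if k is j.+1 then obind next_reflection (reflection_time j) else Some 0%N.

Definition reflection_process (k : nat) : option R :=
  omap reflected_walk (reflection_time k).

End paths.

(* One-step transition probabilities from x to A *)
Section transitions.
Context d (T : measurableType d) (R : realType) (P : probability T R).
Context (Y : nat -> {RV P >-> R}).

Definition walk_transition (x : R) (A : set R) : \bar R :=
  P [set w | A (reflected_walk (fun n => Y n w) x 1)].

Definition reflections_transition (x : R) (A : set R) : \bar R :=
  P [set w | exists2 z,
       reflection_process (fun n => Y n w) x 1 = Some z & A z].

End transitions.

Section invariance.
Context (R : realType) (C : set R) (Q : R -> set R -> \bar R).

Definition invariant_measure (m : {measure set (measurableTypeR R) -> \bar R}) :=
  [/\ m (~` C) = 0%E, m C != 0%E &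
    forall A : set (measurableTypeR R), measurable A -> A `<=` C ->
      (\int[m]_(x in C) Q x A)%E = m A].

Definition radon_measure (m : {measure set (measurableTypeR R) -> \bar R}) :=
  forall K : set R, compact K -> K `<=` C -> (m K < +oo)%E.

Definition unique_invariant_radon_measure
    (m : {measure set (measurableTypeR R) -> \bar R}) :=
  [/\ invariant_measure m, radon_measure m &
    forall m' : {measure set (measurableTypeR R) -> \bar R},
      invariant_measure m' -> radon_measure m' ->
      exists2 c : R, 0 < c &
        forall A : set (measurableTypeR R), measurable A -> m' A = (c%:E * m A)%E].

End invariance.

(* Main.v *)
From HB Require Import structures.
Require Import Defs.
From mathcomp Require Import all_boot all_order all_algebra.
From mathcomp Require Import finmap.
From mathcomp Require Import all_classical all_reals all_analysis.
From mathcomp Require Import measurable_realfun.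
From mathcomp Require Import ring.

Set Implicit Arguments.
Unset Strict Implicit.
Unset Printing Implicit Defensive.
Import Order.TTheory GRing.Theory Num.Theory.
Import numFieldNormedType.Exports.

Local Open Scope classical_set_scope.
Local Open Scope ring_scope.

(** Let [B] be the sub-probability kernel of a step of the walk that is not a
    reflection (from [x] to [x - Y] when [x - Y > 0]) and [A] that of a
    reflecting step (from [x] to [Y - x] when [x - Y <= 0]).  The walk has kernel
    [A + B] ([walk_transitionE]) and, decomposing at the time of the first
    reflection, the reflections have kernel [\sum_n B^n A]
    ([reflections_transitionE]).  The theorem rests on two identities between
    measures,
      [nu A = rho]  ([overshoot_nu])  and  [\sum_n rho B^n = nu]  ([green_rho]).
    They give at once [rho (\sum_n B^n A) = nu A = rho], the invariance of [rho].

    Both identities are computations on densities.  The measure [nu] has density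
    [g u = P (Y > u)].  By Fubini and translation invariance of Lebesgue measure,
    [B] maps a density [h] to the density [T h u = E (h (u + Y))]
    ([descent_shift_duality]).  The density [r] of [rho] satisfies [r + T g = g]
    ([overlap_shift_tail]), so that [r + T r + ... + T^(n-1) r = g - T^n g]; and
    [T^n g] tends to 0 because [E (exp (- Y)) < 1], which holds as soon as [Y] is
    not almost surely 0 ([laplace_lt1], [nneseries_iter_overlap]).  The first
    identity is the substitution [x = Y - u] ([overshoot_tail_duality]).

    For uniqueness, let [m'] be an invariant Radon measure of the reflections and
    put [m = \sum_n m' B^n].  Invariance of [m'] says [m A = m'], whence
    [m (A + B) = m' + m B = m]: the measure [m] is invariant for the walk
    ([occupation_invariant]).  It is moreover Radon ([occupation_radon]): if [mu]
    has bounded support the state space is compact and the series defining [m]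
    converges geometrically, by the same exponential moment; otherwise [m A = m']
    bounds [m] on bounded sets.  If [nu] is the only invariant Radon measure of
    the walk up to constants then [m = c nu], and [m' = m A = c nu A = c rho]. *)

(** * Mixtures of measures *)

Section mixtures.
Local Open Scope ereal_scope.
Context d d' (X : measurableType d) (Z : measurableType d') (R : realType).
Import HBNNSimple.

(** Both sides are additive and continuous along increasing sequences in [f],
    and the hypothesis is the case of indicators, so it suffices to approximate
    [f] by simple functions.  The weight [w] is real-valued so that multiplying
    by it commutes with limits. *)
Lemma integral_mixture (m : {measure set Z -> \bar R})
    (m' : {measure set X -> \bar R}) (w : X -> R)
    (K : X -> {measure set Z -> \bar R}) (f : Z -> \bar R) :
  (forall x, 0 <= w x)%R -> measurable_fun setT w ->
  (forall D, measurable D -> measurable_fun setT (K ^~ D)) ->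
  (forall D, measurable D -> m D = \int[m']_x ((w x)%:E * K x D)) ->
  (forall z, 0 <= f z) -> measurable_fun setT f ->
  \int[m]_z f z = \int[m']_x ((w x)%:E * \int[K x]_z f z).
Proof.
move=> w0 mw mK mE f0 mf.
pose f_ := nnsfun_approx measurableT mf.
have fcvg z : limn (fun n => (f_ n z)%:E) = f z.
  by apply/cvg_lim => //; exact: cvg_nnsfun_approx.
have mf_ n : measurable_fun setT (EFin \o f_ n) by exact/measurable_EFinP.
have f_0 n z : 0 <= (f_ n z)%:E by rewrite lee_fin.
have ndf z : {homo (fun n => (f_ n z)%:E) : a b / (a <= b)%N >-> a <= b}.
  by move=> a b ab; rewrite lee_fin; exact/lefP/nd_nnsfun_approx.
have lim_int (k : {measure set Z -> \bar R}) :
    (\int[k]_z (f_ n z)%:E) @[n --> \oo] --> \int[k]_z f z.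
  under eq_integral do rewrite -fcvg.
  by apply: cvg_monotone_convergence => // z _; exact: ndf.
have nd_int (k : {measure set Z -> \bar R}) :
    {homo (fun n => \int[k]_z (f_ n z)%:E) : a b / (a <= b)%N >-> a <= b}.
  move=> a b ab; apply: ge0_le_integral => //; [exact: mf_|exact: mf_|].
  by move=> z _; exact: ndf.
have mint n : measurable_fun setT (fun x => (w x)%:E * \int[K x]_z (f_ n z)%:E).
  apply: emeasurable_funM; first exact/measurable_EFinP.
  by apply: measurable_fun_integral_kernel => //; exact: mf_.
have step n : \int[m]_z (f_ n z)%:E =
    \int[m']_x ((w x)%:E * \int[K x]_z (f_ n z)%:E).
  rewrite integralT_nnsfun sintegralE.
  under [RHS]eq_integral => x _.
    rewrite integralT_nnsfun sintegralE ge0_mule_fsumr; last first.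
      by move=> r; exact: nnsfun_mulemu_ge0.
    over.
  rewrite ge0_integral_fsum//; last 2 first.
  - move=> r; apply: emeasurable_funM; first exact/measurable_EFinP.
    by apply: measurable_funeM; exact: mK.
  - move=> r x _; apply: mule_ge0; first by rewrite lee_fin.
    exact: nnsfun_mulemu_ge0.
  apply: eq_fsbigr => r; rewrite inE/= => -[z _ rz].
  under eq_integral do rewrite muleCA.
  rewrite ge0_integralZl//; last 3 first.
  - by apply: emeasurable_funM; [exact/measurable_EFinP|exact: mK].
  - by move=> x _; rewrite mule_ge0// lee_fin.
  - by rewrite -rz lee_fin.
  by rewrite -mE.
transitivity (limn (fun n => \int[m]_z (f_ n z)%:E)).
  by apply/esym/cvg_lim => //; exact: lim_int.
under eq_fun do rewrite step.
rewrite -monotone_convergence//.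
- apply: eq_integral => x _; apply/cvg_lim => //.
  by apply: cvgeZl => //; exact: lim_int.
- by move=> n x _; rewrite mule_ge0 ?lee_fin//; exact: integral_ge0.
- by move=> x _ a b ab; apply: lee_wpmul2l; rewrite ?lee_fin//; exact: nd_int.
Qed.

Definition bind (m : {measure set X -> \bar R}) (K : R.-ker X ~> Z) (D : set Z) :=
  \int[m]_x K x D.

Section bind_measure.
Context (m : {measure set X -> \bar R}) (K : R.-ker X ~> Z).

Let bind0 : bind m K set0 = 0.
Proof. by rewrite /bind; apply: integral0_eq => x _. Qed.

Let bind_ge0 D : 0 <= bind m K D.
Proof. exact: integral_ge0. Qed.

Let bind_sigma_additive : semi_sigma_additive (bind m K).
Proof.
move=> F mF tF mUF; rewrite [X in _ --> X](_ : _ = \sum_(n <oo) bind m K (F n)).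
  by apply/cvg_closeP; split; [exact: is_cvg_nneseries|rewrite closeE].
rewrite -integral_nneseries//; last by move=> n; exact: measurable_kernel.
by apply: eq_integral => x _; rewrite measure_semi_bigcup.
Qed.

HB.instance Definition _ := isMeasure.Build _ _ _ (bind m K)
  bind0 bind_ge0 bind_sigma_additive.

Lemma integral_bind (f : Z -> \bar R) :
  (forall z, 0 <= f z) -> measurable_fun setT f ->
  \int[bind m K]_z f z = \int[m]_x \int[K x]_z f z.
Proof.
move=> f0 mf; rewrite (@integral_mixture _ m (cst 1%R) K)//.
- by apply: eq_integral => x _; rewrite mul1e.
- exact: measurable_kernel.
- by move=> D mD; apply: eq_integral => x _; rewrite mul1e.
Qed.

End bind_measure.

End mixtures.

(** The case of Dirac masses.  It covers measures with a density ([phi] is the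
    identity) and images of restricted measures ([w] is an indicator). *)
Lemma integral_weighted_image d d' (X : measurableType d) (Z : measurableType d')
    (R : realType) (m : {measure set Z -> \bar R}) (m' : {measure set X -> \bar R})
    (w : X -> R) (phi : X -> Z) (f : Z -> \bar R) :
  (forall x, 0 <= w x) -> measurable_fun setT w -> measurable_fun setT phi ->
  (forall D, measurable D -> m D = \int[m']_x (w x * \1_D (phi x))%:E)%E ->
  (forall z, 0 <= f z)%E -> measurable_fun setT f ->
  (\int[m]_z f z = \int[m']_x ((w x)%:E * f (phi x)))%E.
Proof.
move=> w0 mw mphi mE f0 mf.
rewrite (@integral_mixture _ _ _ _ _ m m' w (fun x => dirac (phi x)))//.
- by apply: eq_integral => x _; rewrite integral_dirac// diracT mul1e.
move=> D mD; apply/measurable_EFinP.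
by apply: measurableT_comp => //; exact: measurable_indic.
Qed.

(** * Kernels obtained as images of a fixed law *)

Section image_kernel.
Local Open Scope ereal_scope.
Context d1 d2 d3 (X : measurableType d1) (Y : measurableType d2)
  (Z : measurableType d3) (R : realType).
Context (mu : probability Y R) (b : {mfun (X * Y)%type >-> bool})
  (phi : {mfun (X * Y)%type >-> Z}).

(** The image under [phi (x, _)] of [mu] restricted to the event [b (x, _)].
    Bundled measurable functions are used so that the measure and kernel
    structures can be inferred from the term alone. *)
Definition image_measure (x : X) (D : set Z) : \bar R :=
  mu [set y | b (x, y) /\ D (phi (x, y))].

Lemma measurable_image_rel (D : set Z) : measurable D ->
  measurable [set p : X * Y | b p /\ D (phi p)].
Proof.
move=> mD; rewrite [X in measurable X](_ : _ =
    (b @^-1` [set true]) `&` (phi @^-1` D)); last by apply/seteqP; split.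
by apply: measurableI; rewrite -[X in measurable X]setTI; exact: measurable_funP.
Qed.

Lemma xsection_image_rel x (D : set Z) : [set y | b (x, y) /\ D (phi (x, y))] =
  xsection [set p : X * Y | b p /\ D (phi p)] x.
Proof. by apply/seteqP; split => y /=; rewrite /xsection/= inE. Qed.

Lemma measurable_image_event x (D : set Z) : measurable D ->
  measurable [set y | b (x, y) /\ D (phi (x, y))].
Proof.
move=> mD; rewrite xsection_image_rel.
by apply: measurable_xsection; exact: measurable_image_rel.
Qed.

Section measure.
Variable x : X.

Let image0 : image_measure x set0 = 0.
Proof.
by rewrite /image_measure (_ : mkset _ = set0) ?measure0//; apply/seteqP; split => y// [].
Qed.

Let image_ge0 D : 0 <= image_measure x D.
Proof. exact: measure_ge0. Qed.

Let image_sigma_additive : semi_sigma_additive (image_measure x).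
Proof.
move=> F mF tF mUF; rewrite /image_measure.
rewrite (_ : mkset _ = \bigcup_n [set y | b (x, y) /\ F n (phi (x, y))]); last first.
  by apply/seteqP; split => [y [bxy [n _ Fn]]|y [n _ [bxy Fn]]];
    [exists n|split => //; exists n].
apply: measure_semi_sigma_additive.
- by move=> n; exact: measurable_image_event.
- move=> i j _ _ [y [[_ Fi] [_ Fj]]].
  by apply: (tF i j I I); exists (phi (x, y)).
- by apply: bigcup_measurable => n _; exact: measurable_image_event.
Qed.

HB.instance Definition _ := isMeasure.Build _ _ _ (image_measure x)
  image0 image_ge0 image_sigma_additive.

End measure.

Definition image_kernel (x : X) : {measure set Z -> \bar R} := image_measure x.

Let measurable_image_kernel D : measurable D ->
  measurable_fun setT (fun x => image_kernel x D).
Proof.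
move=> mD; rewrite /image_kernel/= /image_measure; under eq_fun do rewrite xsection_image_rel.
by apply: measurable_fun_xsection; exact: measurable_image_rel.
Qed.

HB.instance Definition _ := isKernel.Build _ _ _ _ _
  image_kernel measurable_image_kernel.

Lemma integral_image_kernel x (f : Z -> \bar R) :
  (forall z, 0 <= f z) -> measurable_fun setT f ->
  \int[image_kernel x]_z f z =
  \int[mu]_y (if b (x, y) then f (phi (x, y)) else 0).
Proof.
move=> f0 mf; rewrite (@integral_weighted_image _ _ _ _ _ _ mu
  (fun y => (b (x, y))%:R) (fun y => phi (x, y)))//.
- by apply: eq_integral => y _; case: (b (x, y)); rewrite ?mul1e ?mul0e.
- rewrite (_ : (fun _ => _) = (fun y => if b (x, y) then 1 else 0 : R)%R); last first.
    by apply/funext => y; case: (b _).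
  by apply: measurable_fun_ifT => //; exact: measurableT_comp.
- exact: measurableT_comp.
move=> D mD; under eq_integral => y _.
  rewrite (_ : (_ * _)%R = \1_[set y | b (x, y) /\ D (phi (x, y))] y); last first.
    rewrite !indicE; have [bxy|bxy] := boolP (b (x, y)).
      rewrite mul1r; congr (_ %:R); congr nat_of_bool.
      by apply/idP/idP; rewrite !inE//= => -[].
    by rewrite mul0r memNset//= => -[/(negP bxy)].
  over.
by rewrite integral_indic ?setIT//; exact: measurable_image_event.
Qed.

End image_kernel.

Section image_measure_finite.
Context d1 d2 d3 (X : measurableType d1) (Y : measurableType d2)
  (Z : measurableType d3) (R : realType).
Context (mu : probability Y R) (b : {mfun (X * Y)%type >-> bool})
  (phi : {mfun (X * Y)%type >-> Z}) (x : X).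

Let image_measure_fin_num : fin_num_fun (image_measure mu b phi x).
Proof.
move=> D mD; rewrite ge0_fin_numE// (@le_lt_trans _ _ 1%E) ?ltry//.
apply: probability_le1; exact: measurable_image_event.
Qed.

HB.instance Definition _ := Measure_isFinite.Build _ _ _
  (image_measure mu b phi x) image_measure_fin_num.

End image_measure_finite.

(** * One step of the walk: descents and overshoots *)

Local Notation RR R := (measurableTypeR R).

Section increments.
Context (R : realType).

Definition increment (p : RR R * RR R) : RR R := p.1 - p.2.
Definition above (p : RR R * RR R) : bool := 0 < p.1 - p.2.
Definition excess (p : RR R * RR R) : RR R := p.2 - p.1.
Definition crosses (p : RR R * RR R) : bool := p.1 - p.2 <= 0.

Lemma measurable_increment : measurable_fun setT increment.
Proof. exact: measurable_funB. Qed.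

Lemma measurable_above : measurable_fun setT above.
Proof. by apply: measurable_fun_ltr => //; exact: measurable_increment. Qed.

Lemma measurable_excess : measurable_fun setT excess.
Proof. exact: measurable_funB. Qed.

Lemma measurable_crosses : measurable_fun setT crosses.
Proof. by apply: measurable_fun_ler => //; exact: measurable_increment. Qed.

HB.instance Definition _ := isMeasurableFun.Build _ _ _ _ increment measurable_increment.
HB.instance Definition _ := isMeasurableFun.Build _ _ _ _ above measurable_above.
HB.instance Definition _ := isMeasurableFun.Build _ _ _ _ excess measurable_excess.
HB.instance Definition _ := isMeasurableFun.Build _ _ _ _ crosses measurable_crosses.

Context (mu : probability (RR R) R).

(** The step of the walk from a point, split according to whether it is a
    reflection: [descent] is the part without reflection and [overshoot] the
    part with reflection; both are sub-probability kernels. *)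
Definition descent : R.-ker (RR R) ~> (RR R) := image_kernel mu above increment.
Definition overshoot : R.-ker (RR R) ~> (RR R) := image_kernel mu crosses excess.

(** The distribution after [n] steps of the walk killed at its first
    reflection, when it starts from [m]. *)
Fixpoint killed (m : {measure set (RR R) -> \bar R}) (n : nat) :
  {measure set (RR R) -> \bar R} :=
  if n is k.+1 then bind (killed m k) descent else m.

Definition descent_op (f : R -> \bar R) (x : R) : \bar R := (\int[descent x]_u f u)%E.

Lemma descent_op_ge0 f : (forall x, 0 <= f x)%E -> forall x, (0 <= descent_op f x)%E.
Proof. by move=> f0 x; exact: integral_ge0. Qed.

Lemma measurable_descent_op f : (forall x, 0 <= f x)%E ->
  measurable_fun [set: RR R] f -> measurable_fun [set: RR R] (descent_op f).
Proof.
by move=> f0 mf; apply: measurable_fun_integral_kernel => //; exact: measurable_kernel.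
Qed.

Lemma iter_descent_op_ge0 f n : (forall x, 0 <= f x)%E ->
  forall x, (0 <= iter n descent_op f x)%E.
Proof. by move=> f0; elim: n => //= n IH; exact: descent_op_ge0. Qed.

Lemma measurable_iter_descent_op f n : (forall x, 0 <= f x)%E ->
  measurable_fun [set: RR R] f -> measurable_fun [set: RR R] (iter n descent_op f).
Proof.
move=> f0 mf; elim: n => //= n IH.
by apply: measurable_descent_op => //; exact: iter_descent_op_ge0.
Qed.

Lemma integral_killed m n (f : RR R -> \bar R) :
  (forall x, 0 <= f x)%E -> measurable_fun setT f ->
  (\int[killed m n]_x f x = \int[m]_x iter n descent_op f x)%E.
Proof.
elim: n f => [//|n IH] f f0 mf.
rewrite iterSr -IH; [|exact: descent_op_ge0|exact: measurable_descent_op].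
exact: integral_bind.
Qed.

End increments.

(** * The law of the first reflection *)

Section reflections_law.
Context d (T : measurableType d) (R : realType) (P : probability T R).
Context (Y : nat -> {RV P >-> R}) (mu : probability (RR R) R).
Hypothesis Yindep : mutually_independent (fun n : nat => Y n.+1).
Hypothesis Ydistr : identically_distributed (fun n : nat => Y n.+1) mu.

(** [mutually_independent] and [identically_distributed] use the default
    measurable structure of the reals, whereas Lebesgue measure lives on
    [measurableTypeR]; these have the same measurable sets. *)
Lemma measurable_Y n : measurable_fun setT (Y n : T -> RR R).
Proof.
by move=> mT B mB; exact: (measurable_funP (Y n)).
Qed.

Definition position n (p : RR R * T) : RR R :=
  reflected_walk (fun k => Y k p.2) p.1 n.

Definition unreflected n (p : RR R * T) : bool :=
  all (fun j => ~~ is_reflection (fun k => Y k p.2) p.1 j.+1) (iota 0 n).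

Lemma is_reflectionE n (p : RR R * T) :
  is_reflection (fun k => Y k p.2) p.1 n.+1 = (position n p - Y n.+1 p.2 <= 0).
Proof. by rewrite ler0_def. Qed.

Lemma unreflectedS n p : unreflected n.+1 p =
  unreflected n p && (0 < position n p - Y n.+1 p.2).
Proof.
by rewrite /unreflected -[X in iota _ X]addn1 iotaD all_cat/= andbT is_reflectionE -ltNge.
Qed.

Lemma positionS n p : unreflected n.+1 p ->
  position n.+1 p = position n p - Y n.+1 p.2.
Proof. by rewrite unreflectedS => /andP[_ h]; rewrite /position/= gtr0_norm. Qed.

Lemma measurable_position n : measurable_fun setT (position n).
Proof.
elim: n => [|n IH]; first exact: measurable_fst.
rewrite /position/=; apply: measurableT_comp => //; apply: measurable_funB => //.
exact: measurableT_comp.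
Qed.

HB.instance Definition _ n :=
  isMeasurableFun.Build _ _ _ _ (position n) (measurable_position n).

Definition joint n (p : RR R * T) : RR R * RR R := (position n p, Y n.+1 p.2).

Lemma measurable_joint n : measurable_fun setT (joint n).
Proof.
apply: measurable_fun_pair; first exact: measurable_position.
by apply: measurableT_comp; [exact: measurable_Y|exact: measurable_snd].
Qed.

HB.instance Definition _ n :=
  isMeasurableFun.Build _ _ _ _ (joint n) (measurable_joint n).

Lemma measurable_unreflected n : measurable_fun setT (unreflected n).
Proof.
elim: n => [|n IH]; first exact: measurable_cst.
rewrite (_ : unreflected n.+1 = fun p => unreflected n p && above (joint n p)).
  apply: measurable_and => //.
  exact: (measurableT_comp (@measurable_above R) (measurable_joint n)).
by apply/funext => p; exact: unreflectedS.
Qed.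

HB.instance Definition _ n :=
  isMeasurableFun.Build _ _ _ _ (unreflected n) (measurable_unreflected n).

(** As in [mutually_independent], the constraint of index [i] bears on the
    increment [Y i.+1]: the increments are numbered from 1. *)
Definition future n k (A : nat -> set R) : set T :=
  \bigcap_(i in [set i | (n <= i < k)%N]) (Y i.+1 @^-1` A i).

Lemma measurable_future n k A : (forall i, measurable (A i)) ->
  measurable (future n k A).
Proof.
move=> mA; apply: bigcap_measurableType => i _.
by rewrite -[X in measurable X]setTI; exact: measurable_funP.
Qed.

Lemma probability_future n k A : (forall i, measurable (A i)) ->
  P (future n k A) = (\prod_(n <= i < k) mu (A i))%E.
Proof.
move=> mA; pose J := [fset i in index_iota n k]%fset.
rewrite (_ : future n k A = \bigcap_(i in [set` J]) Y i.+1 @^-1` A i); last first.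
  rewrite /future; congr bigcap; apply/seteqP; split => i /=;
    by rewrite !inE mem_index_iota.
rewrite Yindep//.
rewrite (perm_big (index_iota n k)); last first.
  apply: uniq_perm; rewrite ?fset_uniq ?iota_uniq// => i.
  by rewrite !inE.
by apply: eq_bigr => i _; exact: Ydistr.
Qed.

Definition unreflected_law n (x : RR R) (D : set (RR R)) : \bar R :=
  image_measure P (unreflected n) (position n) x D.

(** The past up to time [n], as seen through [unreflected] and [position], is
    independent of the later increments.  The statement allows an arbitrary
    finite horizon [k] because the induction on [n] consumes one increment. *)
Definition independent_future n x :=
  forall k A (D : set (RR R)), (forall i, measurable (A i)) -> measurable D ->
  (n <= k)%N ->
  (P [set w | (unreflected n (x, w) /\ D (position n (x, w))) /\ future n k A w] =
   unreflected_law n x D * P (future n k A))%E.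

(** Restricted to an event about the increments of index above [n.+1], the pair
    of the position at time [n] and of the next increment has a product law:
    both sides are measures in [Z] that agree on rectangles. *)
Lemma joint_future n x : independent_future n x ->
  forall k A (Z : set (RR R * RR R)), (forall i, measurable (A i)) -> measurable Z ->
  (n < k)%N ->
  (P [set w | (unreflected n (x, w) /\ Z (joint n (x, w))) /\ future n.+1 k A w] =
   (\int[image_measure P (unreflected n) (position n) x]_v mu (xsection Z v)) *
   P (future n.+1 k A))%E.
Proof.
move=> In k A Z mA mZ nk; pose F := future n.+1 k A.
have mF : measurable F by exact: measurable_future.
have mFb : measurable_fun setT (fun p : RR R * T => p.2 \in F).
  apply: (measurable_fun_bool true).
  rewrite setTI (_ : _ @^-1` _ = setT `*` F); first exact: measurableX.
  apply/seteqP; split => -[v w] /=; first by move=> /set_mem.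
  by move=> [_ Fw]; exact: mem_set.
pose bf (p : RR R * T) := unreflected n p && (p.2 \in F).
have mb : measurable_fun setT bf by exact: measurable_and.
pose mbf := isMeasurableFun.Build _ _ _ _ bf mb.
pose b : {mfun (RR R * T)%type >-> bool} := HB.pack bf mbf.
have c0 : 0 <= fine (P F) by exact: fine_ge0.
have PFE : P F = (fine (P F))%:E by rewrite fineK// fin_num_measure.
pose M : {measure set (RR R * RR R) -> \bar R} := image_measure P b (joint n) x.
have M_E D : M D =
  P [set w | unreflected n (x, w) && (w \in F) /\ D (joint n (x, w))] by [].
(* the probability of [F] is absorbed by the second factor of the product *)
have := @product_measure_unique _ _ _ _ _ (image_measure P (unreflected n) (position n) x)
  (mscale (NngNum c0) mu) M.
move=> /(_ _ Z mZ) ME.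
have ->: P [set w | (unreflected n (x, w) /\ Z (joint n (x, w))) /\ F w] = M Z.
  rewrite M_E; congr (P _); apply/seteqP; split => w /=.
    by move=> [[-> ?] Fw]; rewrite mem_set.
  by move=> [/andP[-> /set_mem ?] ?].
rewrite -ME.
  rewrite /product_measure1/= /mscale/=.
  under eq_integral do rewrite muleC.
  rewrite ge0_integralZr// ?lee_fin//; first by rewrite -PFE.
  exact: measurable_fun_xsection.
move=> D E mD mE.
change (M (D `*` E) = unreflected_law n x D * ((fine (P F))%:E * mu E))%E.
rewrite -PFE.
(* the increment [Y n.+1] has index [n] in the family of constraints *)
pose A' i := if i == n then E else A i.
have mA' i : measurable (A' i) by rewrite /A'; case: eqP => _; [exact: mE|exact: mA].
have FA' : P (future n k A') = (mu E * P F)%E.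
  rewrite !probability_future// big_ltn// {1}/A' eqxx; congr (_ * _)%E.
  by apply: eq_big_nat => i /andP[ni _]; rewrite /A' gtn_eqF.
rewrite [(P F * _)%E]muleC -FA' -In//; last exact: ltnW.
rewrite M_E; congr (P _); apply/seteqP; split => w /=.
  move=> [/andP[uw /set_mem Fw] [Dw Ew]]; split => // i /= /andP[].
  rewrite leq_eqVlt /A' => /predU1P[<-|ni] ik; first by rewrite eqxx.
  by rewrite gtn_eqF//; apply: Fw; rewrite /= ni.
move=> [[-> Dw] Fw]; split; last first.
  by split => //; have := Fw n; rewrite /A' eqxx; apply; rewrite /= leqnn.
rewrite mem_set// => i /= /andP[ni ik].
by have := Fw i; rewrite /A' gtn_eqF//; apply; rewrite /= ik ltnW.
Qed.

Lemma unreflectedS_event n x (D : set (RR R)) :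
  [set w | unreflected n.+1 (x, w) /\ D (position n.+1 (x, w))] =
  [set w | unreflected n (x, w) /\
    (above (joint n (x, w)) /\ D (increment (joint n (x, w))))].
Proof.
apply/seteqP; split => w.
  move=> [uw Dw]; have {}Dw : D (position n (x, w) - Y n.+1 (x, w).2).
    by rewrite -(positionS uw).
  have : unreflected n.+1 (x, w) := uw.
  by rewrite unreflectedS => /andP[].
move=> [u1 [u2 Dw]].
have uw : unreflected n.+1 (x, w) by rewrite unreflectedS u1.
by split; rewrite ?(positionS uw).
Qed.

Lemma lawS n x D : independent_future n x -> measurable D ->
  (unreflected_law n.+1 x D =
   \int[image_measure P (unreflected n) (position n) x]_v descent mu v D)%E.
Proof.
move=> In mD.
have mZ := measurable_image_rel (@above R) (@increment R) mD.
have := joint_future In (fun=> measurableT) mZ (leqnn n.+1).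
have -> : future n.+1 n.+1 (fun=> setT) = setT.
  by apply/seteqP; split => // w _ i.
rewrite probability_setT mule1 => E.
rewrite [LHS](congr1 P (unreflectedS_event n x D)).
transitivity (P [set w | (unreflected n (x, w) /\ [set p | above p /\
    D (increment p)] (joint n (x, w))) /\ setT w]).
  by congr (P _); apply/seteqP; split => w //= -[].
by rewrite E; apply: eq_integral => v _; rewrite -xsection_image_rel.
Qed.

Lemma independent_futureP n x : independent_future n x.
Proof.
elim: n => [|n IH] k A D mA mD nk.
  rewrite /unreflected_law /image_measure/=.
  have [Dx|nDx] := pselect (D x).
    rewrite (_ : [set w : T | true /\ _] = setT); last by apply/seteqP; split.
    rewrite probability_setT mul1e; congr (P _).
    by apply/seteqP; split => w //=; case.
  rewrite (_ : [set w : T | true /\ _] = set0); last by apply/seteqP; split => // w [].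
  rewrite measure0 mul0e (_ : mkset _ = set0)//.
  by apply/seteqP; split => // w [[]].
have mZ := measurable_image_rel (@above R) (@increment R) mD.
have := joint_future IH mA mZ nk.
rewrite lawS// => E.
transitivity (P [set w | (unreflected n (x, w) /\ [set p | above p /\
    D (increment p)] (joint n (x, w))) /\ future n.+1 k A w]).
  congr (P _); have /seteqP[sub1 sub2] := unreflectedS_event n x D.
  by apply/seteqP; split => w [? ?]; split => //; [exact: sub1|exact: sub2].
rewrite E; congr (_ * _)%E; apply: eq_integral => v _.
by rewrite -xsection_image_rel.
Qed.

Lemma unreflected_law_killed n x D : measurable D ->
  unreflected_law n x D = killed mu (dirac x) n D.
Proof.
elim: n D => [|n IH] D mD.
  rewrite /unreflected_law /image_measure/= diracE; have [Dx|nDx] := pselect (D x).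
    rewrite mem_set// (_ : [set w : T | true /\ _] = setT) ?probability_setT//.
    by apply/seteqP; split.
  rewrite memNset// (_ : [set w : T | true /\ _] = set0) ?measure0//.
  by apply/seteqP; split => // w [].
rewrite lawS//; last exact: independent_futureP.
by apply: eq_measure_integral => B mB _; exact: IH.
Qed.

Lemma crosses_joint n (p : RR R * T) :
  crosses (joint n p) = is_reflection (fun k => Y k p.2) p.1 n.+1.
Proof. by rewrite is_reflectionE. Qed.

Lemma position_crosses n p : crosses (joint n p) -> position n.+1 p = excess (joint n p).
Proof. by move=> c; rewrite /position/= ler0_norm// opprB. Qed.

Lemma unreflectedP n p : reflect
  (forall j, (j < n)%N -> ~~ is_reflection (fun k => Y k p.2) p.1 j.+1)
  (unreflected n p).
Proof.
apply: (iffP allP) => h j; first by move=> jn; apply: h; rewrite mem_iota.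
by rewrite mem_iota => /andP[_ jn]; exact: h.
Qed.

(** The first reflection is at time [n.+1] exactly when the walk is unreflected
    up to time [n] and the next increment crosses the position. *)
Lemma first_reflectionP (x : RR R) (A : set (RR R)) w :
  (exists2 z, reflection_process (fun n => Y n w) x 1 = Some z & A z) <->
  exists n, unreflected n (x, w) /\
    (crosses (joint n (x, w)) /\ A (excess (joint n (x, w)))).
Proof.
rewrite /reflection_process/= /next_reflection; case: pselect => [e|ne]; last first.
  split; first by case.
  move=> [n [_ [cn _]]]; exfalso; apply: ne; exists n.+1.
  by rewrite /= -(crosses_joint n (x, w)).
case: ex_minnP => -[//|m] /= rm mmin.
have um : unreflected m (x, w).
  apply/unreflectedP => j jm; apply/negP => rj.
  by have := mmin j.+1 rj; rewrite ltnS leqNgt jm.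
have cm : crosses (joint m (x, w)) by rewrite crosses_joint.
split=> [[z [zE] Az]|[n [un [cn An]]]].
  by exists m; split => //; split => //; rewrite -position_crosses// /position/= zE.
have <- : n = m; last first.
  by exists (position n.+1 (x, w)) => //; rewrite position_crosses.
apply/eqP; rewrite eqn_leq; apply/andP; split.
  by rewrite leqNgt; apply/negP => mn; move/unreflectedP : un => /(_ _ mn)/negP.
by rewrite -ltnS; apply: mmin; rewrite -(crosses_joint n (x, w)).
Qed.

(** Decomposition according to the time of the first reflection; the possible
    values of this time give disjoint events. *)
Lemma reflections_transitionE (x : RR R) (A : set (RR R)) : measurable A ->
  (reflections_transition Y x A =
   \sum_(n <oo) \int[killed mu (dirac x) n]_v overshoot mu v A)%E.
Proof.
move=> mA; pose Z : set (RR R * RR R) := [set p | crosses p /\ A (excess p)].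
have mZ : measurable Z by exact: measurable_image_rel.
pose E n := [set w | unreflected n (x, w) /\ Z (joint n (x, w))].
have mE n : measurable (E n) by exact: measurable_image_event.
have tE : trivIset setT E.
  have disj n k w : (n < k)%N -> E n w -> E k w -> False.
    move=> nk [_ [cn _]] [/unreflectedP/(_ _ nk)/negP uk _].
    by apply: uk; rewrite -(crosses_joint n (x, w)).
  move=> n k _ _ [w [En Ek]]; have [nk|nk|//] := ltngtP n k.
    by case: (disj n k w nk En Ek).
  by case: (disj k n w nk Ek En).
transitivity (P (\bigcup_n E n)).
  rewrite /reflections_transition; congr (P _); apply/seteqP; split => w /=.
    by move/first_reflectionP => [n ?]; exists n.
  by move=> [n _ ?]; apply/first_reflectionP; exists n.
rewrite measure_semi_bigcup//; last by apply: bigcup_measurable => n _; exact: mE.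
apply: eq_eseriesr => n _.
have := @joint_future n x (@independent_futureP n x) n.+1 (fun=> setT) Z
  (fun=> measurableT) mZ (leqnn _).
have -> : future n.+1 n.+1 (fun=> setT) = setT by apply/seteqP; split => // w _ i.
rewrite probability_setT mule1 => JE.
transitivity (P [set w | (unreflected n (x, w) /\ Z (joint n (x, w))) /\ setT w]).
  by congr (P _); apply/seteqP; split => w //= -[].
rewrite JE [LHS](eq_measure_integral (killed mu (dirac x) n)); last first.
  by move=> B mB _; exact: unreflected_law_killed.
by apply: eq_integral => v _; rewrite -xsection_image_rel.
Qed.

End reflections_law.

(** * Transition probabilities as operators *)

(** The invariance equations integrate over the state space only; for measures
    that it carries, the integrals can be taken over the whole line. *)
Lemma ge0_integral_full d (X : measurableType d) (R : realType)
    (m : {measure set X -> \bar R}) (C : set X) (f : X -> \bar R) :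
  measurable C -> m (~` C) = 0%E -> (forall x, 0 <= f x)%E -> measurable_fun setT f ->
  (\int[m]_(x in C) f x = \int[m]_x f x)%E.
Proof.
move=> mC mC0 f0 mf.
rewrite [RHS](@ge0_negligible_integral _ _ _ _ _ (~` C))//.
- by rewrite setDE setTI setCK.
- exact: measurableC.
Qed.

Section kernels_of_the_walk.
Context d (T : measurableType d) (R : realType) (P : probability T R).
Context (Y : nat -> {RV P >-> R}) (mu : probability (RR R) R).
Hypothesis Yindep : mutually_independent (fun n : nat => Y n.+1).
Hypothesis Ydistr : identically_distributed (fun n : nat => Y n.+1) mu.

Lemma integral_dirac_killed (x : RR R) n (f : RR R -> \bar R) :
  (forall u, 0 <= f u)%E -> measurable_fun setT f ->
  (\int[killed mu (dirac x) n]_u f u = iter n (descent_op mu) f x)%E.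
Proof.
move=> f0 mf; rewrite integral_killed// integral_dirac ?diracT ?mul1e//.
exact: measurable_iter_descent_op.
Qed.

Lemma reflections_transition_op (A : set (RR R)) : measurable A ->
  reflections_transition Y ^~ A =
  (fun x => \sum_(n <oo) iter n (descent_op mu) (overshoot mu ^~ A) x)%E.
Proof.
move=> mA; apply/funext => x; rewrite (reflections_transitionE Yindep Ydistr)//.
apply: eq_eseriesr => n _; rewrite integral_dirac_killed//.
exact: measurable_kernel.
Qed.

Lemma reflections_transition_ge0 (x : R) (A : set (RR R)) :
  (0 <= reflections_transition Y x A)%E.
Proof. exact: measure_ge0. Qed.

Lemma measurable_reflections_transition (A : set (RR R)) : measurable A ->
  measurable_fun [set: RR R] (reflections_transition Y ^~ A).
Proof.
move=> mA; rewrite reflections_transition_op//.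
have mo := measurable_kernel (overshoot mu) A mA.
apply: ge0_emeasurable_sum => n.
  by move=> x _ _; exact: iter_descent_op_ge0.
by move=> _; exact: measurable_iter_descent_op.
Qed.

Lemma integral_reflections_transition (m : {measure set (RR R) -> \bar R})
    (A : set (RR R)) : measurable A ->
  (\int[m]_x reflections_transition Y x A =
   \sum_(n <oo) \int[killed mu m n]_v overshoot mu v A)%E.
Proof.
move=> mA; rewrite reflections_transition_op//.
have mo := measurable_kernel (overshoot mu) A mA.
rewrite integral_nneseries//; last 2 first.
- by move=> n; exact: measurable_iter_descent_op.
- by move=> n x _; exact: iter_descent_op_ge0.
by apply: eq_eseriesr => n _; rewrite integral_killed.
Qed.

Lemma walk_transitionE (x : RR R) (A : set (RR R)) : measurable A ->
  (walk_transition Y x A = descent mu x A + overshoot mu x A)%E.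
Proof.
move=> mA; rewrite /walk_transition/=.
pose B := [set y : RR R | A `|x - y|].
have BE : B = [set y | above (x, y) /\ A (increment (x, y))] `|`
    [set y | crosses (x, y) /\ A (excess (x, y))].
  rewrite /B /above /crosses /increment /excess/=.
  apply/seteqP; split => y /=.
    have [xy|xy] := leP (x - y) 0; first by rewrite ler0_norm// opprB; right.
    by rewrite gtr0_norm//; left.
  by move=> [[xy]|[xy]]; [rewrite gtr0_norm|rewrite ler0_norm// opprB].
have mabove := measurable_image_event (@above R) (@increment R) x mA.
have mcrosses := measurable_image_event (@crosses R) (@excess R) x mA.
have -> : P [set w | A `|x - Y 1 w|] = mu B.
  by rewrite -(Ydistr 0)//= BE; exact: measurableU.
rewrite BE measureU//.
apply/seteqP; split => // y /= [[+ _] [+ _]].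
by rewrite /above /crosses/= ltNge => /negP.
Qed.

End kernels_of_the_walk.

(** * Translations and reflections of Lebesgue measure *)

Section lebesgue_changes_of_variables.
Context (R : realType).
Local Notation leb := (@lebesgue_measure R).
Local Open Scope ereal_scope.

(** A map that preserves the measure of half-open intervals preserves Lebesgue
    measure, hence integrals. *)
Lemma integral_lebesgue_image (phi : RR R -> RR R) (f : RR R -> \bar R) :
  measurable_fun setT phi ->
  (forall X, ocitv X -> leb X = leb (phi @^-1` X)) ->
  (forall x, 0 <= f x) -> measurable_fun setT f ->
  \int[leb]_x f (phi x) = \int[leb]_x f x.
Proof.
move=> mphi phiE f0 mf.
have phi_leb D : measurable D -> pushforward leb phi D = leb D.
  by move=> mD; apply/esym/lebesgue_measure_unique.
transitivity (\int[pushforward leb phi]_x f x).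
  by rewrite (@ge0_integral_pushforward _ _ _ _ _ phi mphi leb setT).
by apply: (@eq_measure_integral _ _ _ setT leb) => D mD _; exact: phi_leb.
Qed.

Lemma integral_lebesgue_shift (f : RR R -> \bar R) (c : R) :
  (forall x, 0 <= f x) -> measurable_fun setT f ->
  \int[leb]_x f (x + c)%R = \int[leb]_x f x.
Proof.
move=> f0 mf; apply: (@integral_lebesgue_image (fun x => x + c)%R) => //.
  exact: measurable_funD.
move=> _ [[a b] _ <-] /=.
rewrite (_ : (fun x => x + c)%R @^-1` _ = `](a - c)%R, (b - c)%R]%classic); last first.
  by apply/seteqP; split => x /=; rewrite !in_itv/= ltrBlDr lerBrDr.
rewrite !lebesgue_measure_itv/= !lte_fin ltrD2r -!EFinD.
by case: ifP => // _; congr (_ %:E); ring.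
Qed.

Lemma integral_lebesgue_reflect (f : RR R -> \bar R) (c : R) :
  (forall x, 0 <= f x) -> measurable_fun setT f ->
  \int[leb]_x f (c - x)%R = \int[leb]_x f x.
Proof.
move=> f0 mf; apply: (@integral_lebesgue_image (fun x => c - x)%R) => //.
  exact: measurable_funB.
move=> _ [[a b] _ <-] /=.
rewrite (_ : (fun x => c - x)%R @^-1` _ = `[(c - b)%R, (c - a)%R[%classic); last first.
  by apply/seteqP; split => x /=; rewrite !in_itv/= ltrBrDl lerBlDl -ltrBrDr -lerBlDr andbC.
rewrite !lebesgue_measure_itv/= !lte_fin ltrD2l ltrN2 -!EFinD.
by case: ifP => // _; congr (_ %:E); ring.
Qed.

End lebesgue_changes_of_variables.

Section half_line.
Context (R : realType).
Local Open Scope ereal_scope.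

Lemma integral_if d (X : measurableType d) (m : {measure set X -> \bar R}) (b : X -> bool)
    (f : X -> \bar R) :
  \int[m]_x (if b x then f x else 0) = \int[m]_(x in [set x | b x]) f x.
Proof.
rewrite [RHS]integral_mkcond; apply: eq_integral => x _; rewrite /patch.
have [bx|bx] := boolP (b x); first by rewrite mem_set.
by rewrite memNset//=; exact/negP.
Qed.

Lemma integral_pos (m : {measure set (RR R) -> \bar R}) (f : RR R -> \bar R) :
  \int[m]_(x in `]0%R, +oo[) f x = \int[m]_x (if (0 < x)%R then f x else 0).
Proof.
rewrite integral_if; congr integral; apply/seteqP; split => x /=;
  by rewrite in_itv/= andbT.
Qed.

Lemma integral_nneg (m : {measure set (RR R) -> \bar R}) (f : RR R -> \bar R) :
  \int[m]_(x in `[0%R, +oo[) f x = \int[m]_x (if (0 <= x)%R then f x else 0).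
Proof.
rewrite integral_if; congr integral; apply/seteqP; split => x /=;
  by rewrite in_itv/= andbT.
Qed.

Lemma measure_if d (X : measurableType d) (m : {measure set X -> \bar R})
    (b : X -> bool) (D : set X) : measurable D -> (forall x, D x <-> b x) ->
  m D = \int[m]_x (if b x then 1 else 0).
Proof.
move=> mD Db; rewrite integral_if (_ : mkset _ = D) ?integral_cst ?mul1e//.
by apply/seteqP; split => x /=; case: (Db x); auto.
Qed.

End half_line.

(** * Duality between descents and upward shifts *)

Section duality.
Local Open Scope ereal_scope.
Context (R : realType) (mu : probability (RR R) R).
Hypothesis mu_ge0 : mu `]-oo, 0%R[%classic = 0.
Local Notation leb := (@lebesgue_measure R).

Lemma integral_mu_nneg (f : RR R -> \bar R) :
  (forall x, 0 <= f x) -> measurable_fun setT f ->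
  \int[mu]_y f y = \int[mu]_y (if (0 <= y)%R then f y else 0).
Proof.
move=> f0 mf; rewrite -integral_nneg; apply/esym/ge0_integral_full => //.
rewrite (_ : ~` _ = `]-oo, 0%R[%classic)//.
by apply/seteqP; split => x /=; rewrite !in_itv/= andbT ltNge => /negP.
Qed.

(** The expectation of [h (u + Y)]; the test [0 <= y] does not change it and
    makes the substitution [x = u + y] map the half-line into itself. *)
Definition shift_op (h : R -> \bar R) (u : R) :=
  \int[mu]_y (if (0 <= y)%R then h (u + y)%R else 0).

Lemma shift_op_ge0 h : (forall x, 0 <= h x) -> forall u, 0 <= shift_op h u.
Proof. by move=> h0 u; apply: integral_ge0 => y _; case: ifP. Qed.

Lemma measurable_shift_op h : (forall x, 0 <= h x) ->
  measurable_fun [set: RR R] h -> measurable_fun [set: RR R] (shift_op h).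
Proof.
move=> h0 mh.
pose F (p : RR R * RR R) := if (0 <= p.2)%R then h (p.1 + p.2)%R else 0.
apply: (@measurable_fun_fubini_tonelli_F _ _ _ _ _ mu F); last first.
  by move=> p; rewrite /F; case: ifP.
apply: measurable_fun_ifT => //; last first.
  by apply: (measurableT_comp mh); exact: measurable_funD.
exact: measurable_fun_ler.
Qed.

Lemma iter_shift_op_ge0 h n : (forall x, 0 <= h x) ->
  forall u, 0 <= iter n shift_op h u.
Proof. by move=> h0; elim: n => //= n IH; exact: shift_op_ge0. Qed.

Lemma measurable_iter_shift_op h n : (forall x, 0 <= h x) ->
  measurable_fun [set: RR R] h -> measurable_fun [set: RR R] (iter n shift_op h).
Proof.
move=> h0 mh; elim: n => //= n IH.
by apply: measurable_shift_op => //; exact: iter_shift_op_ge0.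
Qed.

(** If a measure has density [h] on the positive half-line, one descent turns
    its density into [shift_op h]: for fixed [y], substitute [x = u + y] in the
    integral of [h x * f (x - y)] over [x > y]. *)
Lemma descent_shift_duality (h f : RR R -> \bar R) :
  (forall x, 0 <= h x) -> (forall x, 0 <= f x) ->
  measurable_fun setT h -> measurable_fun setT f ->
  \int[leb]_(x in `]0%R, +oo[) (h x * descent_op mu f x) =
  \int[leb]_(u in `]0%R, +oo[) (shift_op h u * f u).
Proof.
move=> h0 f0 mh mf; rewrite !integral_pos.
pose F (p : RR R * RR R) := if [&& (0 < p.1)%R, (0 <= p.2)%R & (0 < p.1 - p.2)%R]
  then h p.1 * f (p.1 - p.2)%R else 0.
have F0 p : 0 <= F p by rewrite /F; case: ifP => // _; rewrite mule_ge0.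
have mF : measurable_fun setT F.
  apply: measurable_fun_ifT => //.
    apply: measurable_and; first exact: measurable_fun_ltr.
    apply: measurable_and; first exact: measurable_fun_ler.
    by apply: measurable_fun_ltr => //; exact: measurable_funB.
  apply: emeasurable_funM; first exact: measurableT_comp.
  by apply: (measurableT_comp mf); exact: measurable_funB.
pose G (p : RR R * RR R) := if (0 < p.1)%R && (0 <= p.2)%R
  then h (p.1 + p.2)%R * f p.1 else 0.
have G0 p : 0 <= G p by rewrite /G; case: ifP => // _; rewrite mule_ge0.
have mG : measurable_fun setT G.
  apply: measurable_fun_ifT => //.
    apply: measurable_and; first exact: measurable_fun_ltr.
    exact: measurable_fun_ler.
  apply: emeasurable_funM; last exact: measurableT_comp.
  by apply: (measurableT_comp mh); exact: measurable_funD.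
transitivity (\int[leb]_x \int[mu]_y F (x, y)).
  apply: eq_integral => x _; have [x0|x0] := ltP 0%R x; last first.
    by rewrite integral0_eq// => y _; rewrite /F/= ltNge x0.
  rewrite /descent_op integral_image_kernel//=.
  have mfx : measurable_fun setT
      (fun y : RR R => if above (x, y) then f (increment (x, y)) else 0).
    apply: measurable_fun_ifT => //.
      exact: (measurable_fun_pair2 _ (@measurable_above R)).
    apply: (measurableT_comp mf).
    exact: (measurable_fun_pair2 _ (@measurable_increment R)).
  rewrite -ge0_integralZl//; last by move=> y _; case: ifP.
  rewrite integral_mu_nneg//; last 2 first.
  - by move=> y; rewrite mule_ge0//; case: ifP.
  - exact: measurable_funeM.
  apply: eq_integral => y _; rewrite /F/= x0/= /above/=.
  by case: ifP => // _; case: ifP; rewrite ?mule0.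
rewrite fubini_tonelli//.
transitivity (\int[mu]_y \int[leb]_u G (u, y)).
  apply: eq_integral => y _.
  rewrite -(@integral_lebesgue_shift _ (fun x => F (x, y)) y)//; last first.
    exact: measurable_fun_pair1.
  apply: eq_integral => u _; rewrite /F /G/= addrK.
  have [y0|y0] := leP 0%R y; last by rewrite !andbF.
  rewrite andbT /=; have [u0|u0] := ltP 0%R u; last by rewrite andbF.
  by rewrite ltr_pwDl.
rewrite -fubini_tonelli//.
apply: eq_integral => u _; have [u0|u0] := ltP 0%R u; last first.
  by rewrite integral0_eq// => y _; rewrite /G/= ltNge u0.
rewrite /shift_op muleC -ge0_integralZl//.
- apply: eq_integral => y _; rewrite /G/= u0/=.
  by case: ifP; rewrite ?mule0// muleC.
- apply: measurable_fun_ifT => //; first exact: measurable_fun_ler.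
  by apply: (measurableT_comp mh); exact: measurable_funD.
- by move=> y _; case: ifP.
Qed.

Lemma iter_descent_shift_duality n (h f : RR R -> \bar R) :
  (forall x, 0 <= h x) -> (forall x, 0 <= f x) ->
  measurable_fun setT h -> measurable_fun setT f ->
  \int[leb]_(x in `]0%R, +oo[) (h x * iter n (descent_op mu) f x) =
  \int[leb]_(u in `]0%R, +oo[) (iter n shift_op h u * f u).
Proof.
elim: n f => [//|n IH] f h0 f0 mh mf; rewrite iterSr IH//; last 2 first.
- exact: descent_op_ge0.
- exact: measurable_descent_op.
rewrite descent_shift_duality//.
- exact: iter_shift_op_ge0.
- exact: measurable_iter_shift_op.
Qed.

End duality.

(** * Tail and overlap densities *)

Section densities.
Local Open Scope ereal_scope.
Context (R : realType) (mu : probability (RR R) R).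
Hypothesis mu_ge0 : mu `]-oo, 0%R[%classic = 0.
Local Notation leb := (@lebesgue_measure R).

(** [tail] is the density of [nu], and [overlap] the density of [rho].  The
    closed version [ctail] differs from [tail] at the atoms of [mu] only. *)
Definition tail (u : R) : \bar R := mu `]u, +oo[%classic.
Definition ctail (u : R) : \bar R := mu `[u, +oo[%classic.
Definition overlap (u : R) : \bar R :=
  \int[mu]_(y in `[0%R, +oo[) mu `]u, (u + y)%R]%classic.

Lemma measurable_section (b : RR R * RR R -> bool) :
  measurable_fun setT b -> measurable_fun setT (fun x => mu [set y | b (x, y)]).
Proof.
move=> mb.
rewrite (_ : (fun x => _) = (fun x => mu (xsection (b @^-1` [set true]) x))).
  by apply: measurable_fun_xsection; rewrite -[X in measurable X]setTI; exact: mb.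
apply/funext => x; congr (mu _); apply/seteqP.
by split => y /=; rewrite /xsection/= inE.
Qed.

Lemma measurable_tail : measurable_fun [set: RR R] tail.
Proof.
rewrite (_ : tail = (fun x => mu [set y | (x < y)%R])).
  by apply: (measurable_section (b := fun p => (p.1 < p.2)%R)); exact: measurable_fun_ltr.
by apply/funext => x; congr (mu _); apply/seteqP; split => y /=; rewrite in_itv/= andbT.
Qed.

Lemma measurable_ctail : measurable_fun [set: RR R] ctail.
Proof.
rewrite (_ : ctail = (fun x => mu [set y | (x <= y)%R])).
  by apply: (measurable_section (b := fun p => (p.1 <= p.2)%R)); exact: measurable_fun_ler.
by apply/funext => x; congr (mu _); apply/seteqP; split => y /=; rewrite in_itv/= andbT.
Qed.

Lemma measurable_overlap : measurable_fun [set: RR R] overlap.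
Proof. exact: measurable_rho_density. Qed.

Lemma tail_ge0 u : 0 <= tail u. Proof. exact: measure_ge0. Qed.

Lemma ctail_ge0 u : 0 <= ctail u. Proof. exact: measure_ge0. Qed.

Lemma overlap_ge0 u : 0 <= overlap u. Proof. exact: integral_ge0. Qed.

Lemma tail_le1 u : tail u <= 1.
Proof. exact: probability_le1. Qed.

Lemma tail_fin_num u : tail u \is a fin_num.
Proof. exact: fin_num_measure. Qed.

Lemma mu_nneg : mu `[0%R, +oo[%classic = 1.
Proof.
rewrite -(@probability_setT _ _ _ mu) (_ : setT = `]-oo, 0%R[%classic `|` `[0%R, +oo[%classic).
  rewrite measureU//= ?mu_ge0 ?add0e//.
  by apply/seteqP; split => x //=; rewrite !in_itv/= andbT ltNge => -[/negP].
by rewrite -itv_bndbnd_setU// -set_itvNyy.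
Qed.

(** The ray above [u] is cut at [u + y], then averaged over [y]. *)
Lemma overlap_shift_tail u : overlap u + shift_op mu tail u = tail u.
Proof.
rewrite /shift_op -integral_nneg -ge0_integralD//; last 2 first.
- rewrite (_ : (fun y => mu _) = (fun y => mu [set z | (u < z <= u + y)%R])).
    apply: measurable_funTS.
    apply: (measurable_section (b := fun p => (u < p.2 <= u + p.1)%R)).
    apply: measurable_and; first exact: measurable_fun_ltr.
    by apply: measurable_fun_ler => //; exact: measurable_funD.
  by apply/funext => y; congr (mu _); apply/seteqP; split => z /=; rewrite in_itv.
- apply: measurable_funTS; apply: (measurableT_comp measurable_tail).
  exact: measurable_funD.
transitivity (\int[mu]_(y in `[0%R, +oo[) cst (tail u) y).
  apply: eq_integral => y; rewrite inE/= in_itv/= andbT => y0.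
  rewrite -measureU//=.
  - by rewrite -itv_bndbnd_setU// bnd_simp lerDl.
  - apply/seteqP; split => z //=; rewrite !in_itv/= andbT => -[/andP[_ zu]].
    by rewrite ltNge zu.
by rewrite integral_cst//= mu_nneg mule1.
Qed.

(** For independent [Y] and [Z] with law [mu], both sides are the probability
    that [u < Z <= u + Y], conditioning on [Y] or on [Z]. *)
Lemma overlapE u : overlap u = \int[mu]_y (if (u < y)%R then ctail (y - u)%R else 0).
Proof.
pose F (p : RR R * RR R) : \bar R :=
  if [&& (0 <= p.1)%R, (u < p.2)%R & (p.2 <= u + p.1)%R] then 1 else 0.
have F0 p : 0 <= F p by rewrite /F; case: ifP.
have mF : measurable_fun setT F.
  apply: measurable_fun_ifT => //.
  apply: measurable_and; first exact: measurable_fun_ler.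
  apply: measurable_and; first exact: measurable_fun_ltr.
  by apply: measurable_fun_ler => //; exact: measurable_funD.
transitivity (\int[mu]_y \int[mu]_z F (y, z)).
  rewrite /overlap integral_nneg; apply: eq_integral => y _.
  have [y0|y0] := leP 0%R y; last first.
    by rewrite integral0_eq// => z _; rewrite /F/= leNgt y0.
  rewrite (@measure_if _ _ _ mu (fun z => u < z <= u + y)%R)//.
  by apply: eq_integral => z _; rewrite /F/= y0.
rewrite (fubini_tonelli F mF F0); apply: eq_integral => z _.
have [uz|uz] := ltP u z; last first.
  by rewrite integral0_eq// => y _; rewrite /F/= ltNge uz/= andbF.
rewrite /ctail (@measure_if _ _ _ mu (fun y => z - u <= y)%R)//.
  apply: eq_integral => y _; rewrite /F/= uz/= lerBlDl.
  by case: ifP => [/andP[_ ->]//|]; case: ifP => // zuy /negP; case; rewrite andbT;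
    have := lt_le_trans uz zuy; rewrite ltrDl => /ltW.
by move=> y /=; rewrite in_itv/= andbT.
Qed.

(** The diagonal is null for the product of Lebesgue measure and [mu]. *)
Lemma integral_atoms (f : RR R -> \bar R) :
  (forall x, 0 <= f x) -> measurable_fun setT f ->
  \int[leb]_x (mu [set x] * f x) = 0.
Proof.
move=> f0 mf.
pose F (p : RR R * RR R) : \bar R := if p.1 == p.2 then f p.1 else 0.
have F0 p : 0 <= F p by rewrite /F; case: ifP.
have mF : measurable_fun setT F.
  apply: measurable_fun_ifT => //.
    exact: measurable_fun_eqr.
  exact: measurableT_comp.
transitivity (\int[leb]_x \int[mu]_y F (x, y)).
  apply: eq_integral => x _; rewrite muleC.
  rewrite (@measure_if _ _ _ mu (fun y => x == y))//; last first.
    by move=> y /=; split => [->|/eqP].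
  rewrite -ge0_integralZl//.
  - by apply: eq_integral => y _; rewrite /F/=; case: ifP; rewrite ?mule1 ?mule0.
  - by apply: measurable_fun_ifT => //; exact: measurable_fun_eqr.
  - by move=> y _; case: ifP.
rewrite (fubini_tonelli F mF F0) integral0_eq// => y _.
rewrite /F/= (integral_if leb (fun x => x == y)).
rewrite (_ : mkset _ = [set y]); first exact: integral_set1.
by apply/seteqP; split => x /= /eqP.
Qed.

Lemma integral_ctail (f : RR R -> \bar R) :
  (forall x, 0 <= f x) -> measurable_fun setT f ->
  \int[leb]_(x in `]0%R, +oo[) (ctail x * f x) =
  \int[leb]_(x in `]0%R, +oo[) (tail x * f x).
Proof.
move=> f0 mf.
have matom : measurable_fun setT (fun x : RR R => mu [set x]).
  rewrite (_ : (fun x => _) = (fun x => mu [set y | x == y])).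
    by apply: (measurable_section (b := fun p => p.1 == p.2)); exact: measurable_fun_eqr.
  apply/funext => x; congr (mu _); apply/seteqP.
  by split => y /= => [->|/eqP].
have ctailE x : ctail x = mu [set x] + tail x.
  rewrite /ctail /tail -measureU//=; first by rewrite setU1itv.
  by apply/seteqP; split => z //= [->]; rewrite in_itv/= ltxx.
under eq_integral do rewrite ctailE ge0_muleDl//.
rewrite ge0_integralD//.
- rewrite [X in X + _](_ : _ = 0) ?add0e//; apply/eqP; rewrite eq_le; apply/andP; split.
    rewrite -(integral_atoms f0 mf); apply: ge0_subset_integral => //.
    - exact: emeasurable_funM.
    - by move=> x _; rewrite mule_ge0.
  by apply: integral_ge0 => x _; rewrite mule_ge0.
- by move=> x _; rewrite mule_ge0.
- by apply: emeasurable_funM; exact: measurable_funTS.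
- by move=> x _; rewrite mule_ge0// tail_ge0.
- by apply: emeasurable_funM; apply: measurable_funTS => //; exact: measurable_tail.
Qed.

(** One reflecting step maps the density [tail] to the density [overlap].  For a
    fixed increment [y] the substitution [x = y - u] applies; it produces the
    expression [overlapE] of the overlap provided that [tail] is first replaced
    by [ctail], which is allowed since atoms are Lebesgue-negligible. *)
Lemma overshoot_tail_duality (f : RR R -> \bar R) :
  (forall x, 0 <= f x) -> measurable_fun setT f ->
  \int[leb]_(x in `]0%R, +oo[) (tail x * \int[overshoot mu x]_z f z) =
  \int[leb]_(u in `]0%R, +oo[) (overlap u * f u).
Proof.
move=> f0 mf.
have mof : measurable_fun setT (fun x => \int[overshoot mu x]_z f z).
  by apply: measurable_fun_integral_kernel => //; exact: measurable_kernel.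
rewrite -integral_ctail//; last by move=> x; exact: integral_ge0.
pose F (p : RR R * RR R) := if (0 < p.1)%R && (p.1 - p.2 <= 0)%R
  then ctail p.1 * f (p.2 - p.1)%R else 0.
have F0 p : 0 <= F p by rewrite /F; case: ifP => // _; rewrite mule_ge0.
have mF : measurable_fun setT F.
  apply: measurable_fun_ifT => //.
    apply: measurable_and; first exact: measurable_fun_ltr.
    by apply: measurable_fun_ler => //; exact: measurable_funB.
  apply: emeasurable_funM; first exact: (measurableT_comp measurable_ctail).
  by apply: (measurableT_comp mf); exact: measurable_funB.
pose G (p : RR R * RR R) := if (0 <= p.1)%R && (p.1 < p.2)%R
  then ctail (p.2 - p.1)%R * f p.1 else 0.
have G0 p : 0 <= G p by rewrite /G; case: ifP => // _; rewrite mule_ge0.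
have mG : measurable_fun setT G.
  apply: measurable_fun_ifT => //.
    apply: measurable_and; first exact: measurable_fun_ler.
    exact: measurable_fun_ltr.
  apply: emeasurable_funM; last exact: measurableT_comp.
  by apply: (measurableT_comp measurable_ctail); exact: measurable_funB.
transitivity (\int[leb]_x \int[mu]_y F (x, y)).
  rewrite integral_pos; apply: eq_integral => x _.
  have [x0|x0] := ltP 0%R x; last first.
    by rewrite integral0_eq// => y _; rewrite /F/= ltNge x0.
  rewrite integral_image_kernel//= -ge0_integralZl//.
  - by apply: eq_integral => y _; rewrite /F/= x0/= /crosses/=; case: ifP; rewrite ?mule0.
  - apply: measurable_fun_ifT => //.
      exact: (measurable_fun_pair2 _ (@measurable_crosses R)).
    apply: (measurableT_comp mf).
    exact: (measurable_fun_pair2 _ (@measurable_excess R)).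
  - by move=> y _; case: ifP.
rewrite (fubini_tonelli F mF F0).
transitivity (\int[mu]_y \int[leb]_u G (u, y)).
  apply: eq_integral => y _.
  rewrite -(@integral_lebesgue_reflect _ (fun x => F (x, y)) y)//; last first.
    exact: measurable_fun_pair1.
  apply: eq_integral => u _; rewrite /F /G/= subr_gt0 andbC opprB addrCA subrr addr0.
  by rewrite addrAC subrr sub0r oppr_le0.
rewrite -(fubini_tonelli G mG G0).
rewrite (@integral_itv_obnd_cbnd _ 0%R (BInfty _ false)); last first.
  by apply: measurable_funTS; apply: emeasurable_funM => //; exact: measurable_overlap.
rewrite integral_nneg; apply: eq_integral => u _.
have [u0|u0] := leP 0%R u; last first.
  by rewrite integral0_eq// => y _; rewrite /G/= leNgt u0.
rewrite overlapE muleC -ge0_integralZl//.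
- apply: eq_integral => y _; rewrite /G/= u0/=.
  by case: ifP; rewrite ?mule0// muleC.
- apply: measurable_fun_ifT => //; first exact: measurable_fun_ltr.
  by apply: (measurableT_comp measurable_ctail); exact: measurable_funB.
- by move=> y _; case: ifP => // _; exact: ctail_ge0.
Qed.

End densities.

(** * The support of the law *)

Section support.
Context (R : realType) (mu : probability (RR R) R).

(** A point off the support lies in a null interval with rational endpoints,
    and there are countably many of these. *)
Lemma measure_off_supp (A : set (RR R)) :
  measurable A -> A `&` supp mu = set0 -> mu A = 0%E.
Proof.
move=> mA A0.
pose I (z : rat * rat) : set (RR R) := `]ratr z.1, ratr z.2[%classic.
pose F n : set (RR R) := if (choice.unpickle n : option (rat * rat)) is Some z then
  if mu (I z) == 0%E then I z else set0 else set0.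
apply: measure_negligible => //.
apply: (@negligibleS _ _ _ _ (\bigcup_n F n)); last first.
  apply: negligible_bigcup => n; rewrite /F.
  case: (choice.unpickle n : option (rat * rat)) => [z|]; last exact: negligible_set0.
  case: eqP => [Iz|_]; last exact: negligible_set0.
  by apply/negligibleP => //; exact: measurable_itv.
move=> x Ax.
have : ~ supp mu x by move=> sx; suff : (A `&` supp mu) x by rewrite A0.
move=> /existsNP[U] /not_implyP[oU] /not_implyP[Ux] /negP; rewrite -leNgt => U0.
have /nbhs_ballP[e /= e0 eU] : nbhs x U by exact: open_nbhs_nbhs.
have [p] : exists q : rat, ratr q \in `](x - e)%R, x[.
  by apply: rat_in_itvoo; rewrite ltrBlDr ltrDl.
rewrite in_itv/= => /andP[ep px].
have [q] : exists q : rat, ratr q \in `]x, (x + e)%R[.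
  by apply: rat_in_itvoo; rewrite ltrDl.
rewrite in_itv/= => /andP[xq qe].
have I0 : mu (I (p, q)) = 0%E.
  apply/eqP; rewrite eq_le measure_ge0 andbT (le_trans _ U0)//.
  apply: le_measure; rewrite ?inE.
  - exact: measurable_itv.
  - exact: open_measurable.
  - move=> z; rewrite /I/= in_itv/= => /andP[pz zq]; apply: eU.
    by rewrite ball_itv/= in_itv/= (lt_trans ep)// (lt_trans zq).
have FE : F (choice.pickle (p, q)) = I (p, q).
  by rewrite /F choice.pickleK I0 eqxx.
exists (choice.pickle (p, q)); [exact: Logic.I|rewrite FE].
by rewrite /I/= in_itv/= px xq.
Qed.

Lemma supp_nonempty : supp mu !=set0.
Proof.
apply/set0P/eqP => s0.
have := @probability_setT _ _ _ mu; rewrite measure_off_supp ?s0 ?setI0//.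
by move=> /esym/eqP; rewrite onee_eq0.
Qed.

Lemma supN_gtNy : (-oo < supN mu)%E.
Proof.
have [x sx] := supp_nonempty; rewrite (lt_le_trans (ltNyr x))//.
by apply: ereal_sup_ubound; exists x.
Qed.

Lemma tail_off_state_space x : 0 <= x -> ~ state_space mu x -> tail mu x = 0%E.
Proof.
move=> x0 nx; apply: measure_off_supp => //; apply/seteqP; split => // z /= [].
rewrite in_itv/= andbT => xz sz; apply: nx; split => //.
rewrite (le_trans _ (ereal_sup_ubound _ : z%:E <= _)%E)//; first by rewrite lee_fin ltW.
by exists z.
Qed.

Lemma overlap_off_state_space x : 0 <= x -> ~ state_space mu x -> overlap mu x = 0%E.
Proof.
move=> x0 nx; apply: integral0_eq => y _; apply/eqP; rewrite eq_le measure_ge0 andbT.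
rewrite -(tail_off_state_space x0 nx); apply: le_measure; rewrite ?inE//.
by move=> z /=; rewrite !in_itv/= andbT => /andP[].
Qed.

End support.

(** * Integrals against the measures nu and rho *)

Section integrals_against_nu_rho.
Local Open Scope ereal_scope.
Context (R : realType) (mu : probability (RR R) R).
Hypothesis mu_ge0 : mu `]-oo, 0%R[%classic = 0.
Local Notation leb := (@lebesgue_measure R).
Local Notation C := (state_space mu).

(** Replacing the state space by the open half-line changes the domain by the
    null point 0 and by points beyond the support, where [h] vanishes. *)
Lemma integral_density (m : {measure set (RR R) -> \bar R}) (h f : RR R -> \bar R) :
  (forall x, 0 <= h x) -> (forall x, h x \is a fin_num) -> measurable_fun setT h ->
  (forall x, (0 <= x)%R -> ~ C x -> h x = 0) ->
  (forall D, measurable D -> m D = \int[leb]_(x in D `&` C) h x) ->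
  (forall x, 0 <= f x) -> measurable_fun setT f ->
  \int[m]_x f x = \int[leb]_(x in `]0%R, +oo[) (h x * f x).
Proof.
move=> h0 hfin mh hC mE f0 mf.
pose w x := (if 0 < x then fine (h x) else 0)%R.
rewrite (@integral_weighted_image _ _ _ _ _ m leb w id)//.
- rewrite integral_pos; apply: eq_integral => x _; rewrite /w.
  by case: ifP; rewrite ?mul0e// fineK.
- by move=> x; rewrite /w; case: ifP => // _; exact: fine_ge0.
- apply: measurable_fun_ifT => //; first exact: measurable_fun_ltr.
  exact: measurableT_comp.
move=> D mD; rewrite mE//.
have mDC : measurable (D `&` C) by apply: measurableI => //; exact: measurable_state_space.
rewrite (@ge0_negligible_integral _ _ _ leb (D `&` C) [set 0%R])//; last 2 first.
- exact: measurable_funTS.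
- exact: lebesgue_measure_set1.
rewrite integral_mkcond; apply: eq_integral => x _; rewrite /patch /w indicE.
have [x0|x0] := ltP 0%R x; last first.
  rewrite mul0r ifF//; apply/negP; rewrite inE/= => -[[_ [x0' _]] xn0].
  by apply: xn0; apply/eqP; rewrite eq_le x0 x0'.
have [Dx|nDx] := pselect (D x); last first.
  rewrite [x \in D]memNset// mulr0 ifF//; apply/negP; rewrite inE/= => -[[Dx _] _].
  exact: nDx.
rewrite [x \in D]mem_set// mulr1 fineK//.
have [Cx|nCx] := pselect (C x).
  by rewrite mem_set//; split => //= xE; rewrite xE ltxx in x0.
by rewrite hC// ?ltW//; case: ifP.
Qed.

Lemma nu_densityE x : (0 <= x)%R -> 1 - cumul mu x = tail mu x.
Proof.
move=> x0; rewrite -(mu_nneg mu_ge0).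
rewrite (_ : `[0%R, +oo[%classic =
    `[0%R, x]%classic `|` `]x, +oo[%classic :> set R); last first.
  by rewrite -itv_bndbnd_setU// bnd_simp.
rewrite measureU//=.
  by rewrite /cumul addeAC subee ?add0e// fin_num_measure.
by apply/seteqP; split => z //=; rewrite !in_itv/= andbT => -[/andP[_ zx]]; rewrite ltNge zx.
Qed.

Lemma integral_nu (f : RR R -> \bar R) :
  (forall x, 0 <= f x) -> measurable_fun setT f ->
  \int[nu mu]_x f x = \int[leb]_(x in `]0%R, +oo[) (tail mu x * f x).
Proof.
move=> f0 mf; apply: integral_density => //.
- exact: tail_fin_num.
- exact: measurable_tail.
- exact: tail_off_state_space.
- move=> D mD; rewrite /= /nu; apply: eq_integral => x; rewrite inE/= => -[_ [x0 _]].
  exact: nu_densityE.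
Qed.

Lemma overlap_le_tail x : overlap mu x <= tail mu x.
Proof.
by rewrite -[leRHS](overlap_shift_tail mu_ge0) leeDl// shift_op_ge0.
Qed.

Lemma integral_rho (f : RR R -> \bar R) :
  (forall x, 0 <= f x) -> measurable_fun setT f ->
  \int[rho mu]_x f x = \int[leb]_(x in `]0%R, +oo[) (overlap mu x * f x).
Proof.
move=> f0 mf; apply: integral_density => //.
- exact: overlap_ge0.
- move=> x; rewrite ge0_fin_numE ?overlap_ge0// (le_lt_trans (overlap_le_tail x))//.
  by rewrite ltey_eq tail_fin_num.
- exact: measurable_overlap.
- exact: overlap_off_state_space.
Qed.

End integrals_against_nu_rho.

(** * Exponential moments of the law *)

Section laplace.
Local Open Scope ereal_scope.
Context (R : realType) (mu : probability (RR R) R).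
Hypothesis mu_ge0 : mu `]-oo, 0%R[%classic = 0.
Hypothesis mu_not0 : mu [set 0%R] != 1.

Lemma tail_gt0 : exists2 a : R, (0 < a)%R & 0 < tail mu a.
Proof.
apply: contrapT => /forall2NP noa.
have : mu `]0%R, +oo[%classic = 0.
  apply: measure_negligible => //.
  pose F n : set (RR R) := `](n.+1%:R^-1)%R, +oo[%classic.
  apply: (@negligibleS _ _ _ _ (\bigcup_n F n)); last first.
    apply: negligible_bigcup => n; apply/negligibleP; first exact: measurable_itv.
    have [/negP|/negP] := noa (n.+1%:R^-1)%R; first by rewrite invr_gt0 ltr0n.
    by rewrite -leNgt => t0; apply/eqP; rewrite eq_le measure_ge0 andbT.
  move=> x /=; rewrite in_itv/= andbT => x0.
  exists (Num.truncn (x^-1)%R) => //; rewrite /F/= in_itv/= andbT.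
  by rewrite invf_plt ?posrE// truncnS_gt.
move=> pos0; move/eqP : mu_not0; apply.
rewrite -(mu_nneg mu_ge0).
rewrite (_ : `[0%R, +oo[%classic = 0%R |` `]0%R, +oo[%classic :> set R); last first.
  by rewrite setU1itv.
rewrite measureU//= ?pos0 ?adde0//.
by apply/seteqP; split => z //= [->]; rewrite in_itv/= ltxx.
Qed.

Lemma measurable_expN_nneg : measurable_fun setT
  (fun y : RR R => if (0 <= y)%R then (expR (- y))%:E else 0).
Proof.
apply: measurable_fun_ifT => //; first exact: measurable_fun_ler.
by apply/measurable_EFinP; apply: measurableT_comp.
Qed.

(** If [Y > a] has positive probability [t], the expectation of [exp (- Y)] is
    at most [1 - (1 - exp (- a)) * t]. *)
Lemma laplace_lt1 : exists q : R, [/\ (0 <= q)%R, (q < 1)%R &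
  \int[mu]_y (if (0 <= y)%R then (expR (- y))%:E else 0) <= q%:E].
Proof.
have [a a0 ta] := tail_gt0.
pose c : R := (1 - expR (- a))%R.
have c0 : (0 < c)%R by rewrite subr_gt0 expR_lt1 oppr_lt0.
have c1 : (c <= 1)%R by rewrite lerBlDr lerDl expR_ge0.
pose t := fine (tail mu a).
have tE : tail mu a = t%:E by rewrite fineK// tail_fin_num.
have t0 : (0 < t)%R by rewrite -lte_fin -tE.
have t1 : (t <= 1)%R by rewrite -lee_fin -tE tail_le1.
exists (1 - c * t)%R; split.
- by rewrite subr_ge0 mulr_ile1// ltW.
- by rewrite ltrBlDr ltrDl mulr_gt0.
have mexp := measurable_expN_nneg.
rewrite EFinB leeBrDr//.
have -> : (c * t)%:E = \int[mu]_y (if (a < y)%R then c%:E else 0).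
  rewrite integral_if integral_cst//=; last first.
    rewrite (_ : mkset _ = `]a, +oo[%classic)//.
    by apply/seteqP; split => y /=; rewrite in_itv/= andbT.
  rewrite EFinM -tE /tail; congr (_ * mu _).
  by apply/seteqP; split => y /=; rewrite in_itv/= andbT.
rewrite -ge0_integralD//.
- rewrite (@le_trans _ _ (\int[mu]_y cst 1 y))//.
    apply: ge0_le_integral => //.
    + by move=> y _; apply: adde_ge0; case: ifP => // _; rewrite lee_fin ?expR_ge0// ltW.
    + apply: emeasurable_funD => //; apply: measurable_fun_ifT => //.
      exact: measurable_fun_ltr.
    + move=> y _ /=; case: ifPn => [y0|]; last first.
        by rewrite -ltNge => y0; rewrite add0e; case: ifP => // _; rewrite lee_fin.
      case: ifPn => [ay|_].
        rewrite -EFinD lee_fin /c addrCA gerDl subr_le0 ler_expR lerN2 ltW//.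
      by rewrite adde0 lee_fin -expR0 ler_expR oppr_le0.
  by rewrite integral_cst// mul1e probability_le1.
- by move=> y _; case: ifP => // _; rewrite lee_fin expR_ge0.
- by move=> y _; case: ifP => // _; rewrite lee_fin ltW.
- by apply: measurable_fun_ifT => //; exact: measurable_fun_ltr.
Qed.

Lemma tail_small (e : R) : (0 < e)%R -> exists L : R, tail mu L <= e%:E.
Proof.
move=> e0; pose F n : set (RR R) := `](n%:R : R), +oo[%classic.
have F0 : \bigcap_n F n = set0.
  apply/seteqP; split => // x Fx; have := Fx (Num.truncn x).+1 Logic.I.
  rewrite /F/= in_itv/= andbT => h.
  by have := lt_trans (truncnS_gt x) h; rewrite ltxx.
have h1 : mu (F 0%N) < +oo by rewrite ltey_eq fin_num_measure//; exact: measurable_itv.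
have h2 i : measurable (F i) by exact: measurable_itv.
have h4 : {homo F : n m / (n <= m)%N >-> (m <= n)%O}.
  move=> n k nk; apply/subsetPset => x; rewrite /F/= !in_itv/= !andbT.
  by apply: le_lt_trans; rewrite ler_nat.
have := @nonincreasing_cvg_mu _ _ _ mu F.
rewrite F0 measure0 => /(_ h1 h2 measurable0 h4).
move=> /fine_cvgP[_ /cvgrPdist_le /(_ _ e0)[N _ /(_ N (leqnn _))]].
rewrite /= sub0r normrN ger0_norm ?fine_ge0// => h.
by exists N%:R; rewrite -(fineK (tail_fin_num mu N%:R)) lee_fin.
Qed.

End laplace.

(** * The potential of rho is nu *)

Section green.
Local Open Scope ereal_scope.
Context (R : realType) (mu : probability (RR R) R).
Hypothesis mu_ge0 : mu `]-oo, 0%R[%classic = 0.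
Hypothesis mu_not0 : mu [set 0%R] != 1.
Local Notation leb := (@lebesgue_measure R).
Local Notation C := (state_space mu).
Local Notation T := (shift_op mu).

Lemma shift_opD h k : (forall x, 0 <= h x) -> (forall x, 0 <= k x) ->
  measurable_fun [set: RR R] h -> measurable_fun [set: RR R] k ->
  T (fun x => h x + k x) = (fun x => T h x + T k x).
Proof.
move=> h0 k0 mh mk; apply/funext => u; rewrite /shift_op -!integral_nneg.
rewrite ge0_integralD//.
- by apply: measurable_funTS; apply: (measurableT_comp mh); exact: measurable_funD.
- by apply: measurable_funTS; apply: (measurableT_comp mk); exact: measurable_funD.
Qed.

Lemma iter_overlap_shift_tail n :
  (fun u => iter n T (overlap mu) u + iter n.+1 T (tail mu) u) =
  iter n T (tail mu).
Proof.
elim: n => [|n IH]; first by apply/funext => u; exact: overlap_shift_tail.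
rewrite [RHS]iterS -IH shift_opD//.
- by move=> x; apply: iter_shift_op_ge0 => y; exact: overlap_ge0.
- by move=> x; apply: (@iter_shift_op_ge0 _ _ _ n.+1) => y; exact: tail_ge0.
- apply: measurable_iter_shift_op; [exact: overlap_ge0|exact: measurable_overlap].
- by apply: (@measurable_iter_shift_op _ _ _ n.+1); [exact: tail_ge0|exact: measurable_tail].
Qed.

Lemma sum_iter_overlap n u :
  \sum_(0 <= k < n) iter k T (overlap mu) u + iter n T (tail mu) u = tail mu u.
Proof.
elim: n => [|n IH]; first by rewrite big_nil add0e.
have /= E := congr1 (fun h => h u) (iter_overlap_shift_tail n).
by rewrite big_nat_recr//= -addeA E IH.
Qed.

(** [tail] is dominated by [e + exp (L - u)].  The shift operator fixes the
    constant and multiplies the exponential by the expectation of [exp (- Y)],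
    so iterating it leaves at most [e] in the limit. *)
Lemma iter_shift_tail_bound (e q L : R) n : (0 <= e)%R -> (0 <= q)%R ->
  \int[mu]_y (if (0 <= y)%R then (expR (- y))%:E else 0) <= q%:E ->
  tail mu L <= e%:E ->
  forall u, iter n T (tail mu) u <= (e + q ^+ n * expR (L - u))%:E.
Proof.
move=> e0 q0 lap tL; elim: n => [|n IH] u.
  rewrite expr0 mul1r /=; have [Lu|uL] := leP L u.
    rewrite (@le_trans _ _ (tail mu L))//.
      by apply: le_measure; rewrite ?inE//; apply: subset_itvr; rewrite bnd_simp.
    by rewrite (le_trans tL)// lee_fin lerDl expR_ge0.
  rewrite (le_trans (tail_le1 _ _))// lee_fin (@le_trans _ _ (expR (L - u)))//.
    by rewrite -expR0 ler_expR subr_ge0 ltW.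
  by rewrite lerDr.
have mexp := @measurable_expN_nneg R.
pose K := (q ^+ n * expR (L - u))%R.
have K0 : (0 <= K)%R by rewrite mulr_ge0 ?exprn_ge0// expR_ge0.
rewrite iterS /shift_op.
apply: (@le_trans _ _ (\int[mu]_y
    (e%:E + K%:E * (if (0 <= y)%R then (expR (- y))%:E else 0)))).
  apply: ge0_le_integral => //.
  - by move=> y _; case: ifP => // _; apply: iter_shift_op_ge0 => x; exact: tail_ge0.
  - apply: measurable_fun_ifT => //; first exact: measurable_fun_ler.
    apply: (measurableT_comp (f := iter n T (tail mu))); last exact: measurable_funD.
    by apply: measurable_iter_shift_op; [exact: tail_ge0|exact: measurable_tail].
  - apply: emeasurable_funD => //; exact: measurable_funeM.
  - move=> y _; case: ifP => [y0|]; last by rewrite mule0 adde0 lee_fin.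
    rewrite (le_trans (IH _))// lee_fin lerD2l /K -mulrA -expRD.
    by rewrite opprD addrA.
rewrite ge0_integralD//; last 2 first.
- by move=> y _; rewrite mule_ge0//; case: ifP; rewrite // lee_fin expR_ge0.
- exact: measurable_funeM.
have -> : \int[mu]__ e%:E = e%:E.
  rewrite (integral_cst mu measurableT e%:E).
  by rewrite [X in _ * X](_ : _ = 1) ?mule1//; exact: probability_setT.
rewrite EFinD leeD2l//.
rewrite ge0_integralZl//; last first.
  by move=> y _; case: ifP; rewrite // lee_fin expR_ge0.
have -> : (q ^+ n.+1 * expR (L - u) = K * q)%R by rewrite /K exprSr mulrAC.
rewrite [leRHS]EFinM.
by apply: lee_wpmul2l => //; rewrite lee_fin.
Qed.

(** By [sum_iter_overlap] the partial sums telescope to [tail] minus its [n]-th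
    shift, and the latter vanishes in the limit. *)
Lemma nneseries_iter_overlap u :
  \sum_(n <oo) iter n T (overlap mu) u = tail mu u.
Proof.
have o0 n x : 0 <= iter n T (overlap mu) x.
  by apply: iter_shift_op_ge0 => y; exact: overlap_ge0.
have t0 n x : 0 <= iter n T (tail mu) x.
  by apply: iter_shift_op_ge0 => y; exact: tail_ge0.
apply/eqP; rewrite eq_le; apply/andP; split.
  apply: lime_le; first by apply: is_cvg_nneseries => n _ _; exact: o0.
  by apply: nearW => n; rewrite -[leRHS](sum_iter_overlap n u) leeDl.
apply/lee_addgt0Pr => e e0.
have [q [q0 q1 lap]] := laplace_lt1 mu_ge0 mu_not0.
have e20 : (0 < e / 2)%R by rewrite divr_gt0.
have [L tL] := tail_small mu e20.
have [n qn] : exists n, (q ^+ n * expR (L - u) <= e / 2)%R.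
  have : (q ^+ n)%R @[n --> \oo] --> (0 : R)%R.
    by apply: cvg_expr; rewrite ger0_norm.
  have d0 : (0 < e / 2 / expR (L - u))%R by rewrite divr_gt0// expR_gt0.
  move=> /cvgrPdist_le/(_ _ d0)[n _ /(_ n (leqnn _))] /=.
  rewrite sub0r normrN ger0_norm ?exprn_ge0// ler_pdivlMr ?expR_gt0// => h.
  by exists n.
rewrite -[leLHS](sum_iter_overlap n u) leeD//.
  by apply: nneseries_lim_ge => k _ _; exact: o0.
rewrite (le_trans (iter_shift_tail_bound n (ltW e20) q0 lap tL u))// lee_fin.
by rewrite [leRHS](splitr e) lerD2l.
Qed.

(** The total time spent by the killed walk started from [rho] is [nu]: on
    densities, this is [nneseries_iter_overlap]. *)
Lemma green_rho (f : RR R -> R) :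
  (forall x, 0 <= f x)%R -> measurable_fun setT f ->
  \sum_(n <oo) \int[killed mu (rho mu) n]_x (f x)%:E = \int[nu mu]_x (f x)%:E.
Proof.
move=> f0 mf.
have ef0 x : 0 <= (f x)%:E by rewrite lee_fin.
have mef : measurable_fun setT (EFin \o f) by exact/measurable_EFinP.
have o0 n x : 0 <= iter n T (overlap mu) x.
  by apply: iter_shift_op_ge0 => y; exact: overlap_ge0.
rewrite integral_nu//.
transitivity (\sum_(n <oo) \int[leb]_(x in `]0%R, +oo[)
    (iter n T (overlap mu) x * (f x)%:E)).
  apply: eq_eseriesr => n _; rewrite integral_killed// integral_rho//.
  - rewrite iter_descent_shift_duality//; [exact: overlap_ge0|exact: measurable_overlap].
  - exact: iter_descent_op_ge0.
  - exact: measurable_iter_descent_op.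
rewrite -integral_nneseries//.
- apply: eq_integral => x _; rewrite -nneseries_iter_overlap muleC -nneseriesZl//.
  by apply: eq_eseriesr => n _; rewrite muleC.
- move=> n; apply: measurable_funTS; apply: emeasurable_funM => //.
  by apply: measurable_iter_shift_op; [exact: overlap_ge0|exact: measurable_overlap].
- by move=> n x _; rewrite mule_ge0.
Qed.

Lemma overshoot_nu (A : set (RR R)) : measurable A ->
  \int[nu mu]_x overshoot mu x A = rho mu A.
Proof.
move=> mA; rewrite integral_nu//; last exact: measurable_kernel.
transitivity (\int[leb]_(x in `]0%R, +oo[) (tail mu x * \int[overshoot mu x]_z (\1_A z)%:E)).
  by apply: eq_integral => x _; rewrite integral_indic// setIT.
rewrite overshoot_tail_duality//; last by apply/measurable_EFinP; exact: measurable_indic.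
rewrite -integral_rho//; last by apply/measurable_EFinP; exact: measurable_indic.
by rewrite integral_indic// setIT.
Qed.

Lemma nu_gt0 : nu mu setT != 0.
Proof.
have [a a0 ta] := tail_gt0 mu_ge0 mu_not0.
have -> : nu mu setT = \int[nu mu]_x (cst 1 x) by rewrite integral_cst// mul1e.
rewrite integral_nu// gt_eqF//.
apply: (@lt_le_trans _ _ (\int[leb]_(x in `]0%R, a[) (cst (tail mu a) x))).
  rewrite integral_cst//= lebesgue_measure_itv/= lte_fin a0 sube0.
  by rewrite mule_gt0.
apply: (@le_trans _ _ (\int[leb]_(x in `]0%R, a[) (tail mu x * 1))).
  apply: ge0_le_integral => //.
  - by apply: measurable_funTS; apply: emeasurable_funM => //; exact: measurable_tail.
  - move=> x /=; rewrite in_itv/= => /andP[_ xa]; rewrite mule1.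
    apply: le_measure; rewrite ?inE//.
    by apply: subset_itvr; rewrite bnd_simp ltW.
apply: ge0_subset_integral => //.
- by apply: measurable_funTS; apply: emeasurable_funM => //; exact: measurable_tail.
- by move=> x _; rewrite mule1 tail_ge0.
- by apply: subset_itvl; rewrite bnd_simp.
Qed.

End green.

(** * Invariance of rho, and the occupation measure *)

Section invariance_and_occupation.
Local Open Scope ereal_scope.
Context d (T : measurableType d) (R : realType) (P : probability T R).
Context (Y : nat -> {RV P >-> R}) (mu : probability (RR R) R).
Hypothesis Yindep : mutually_independent (fun n : nat => Y n.+1).
Hypothesis Ydistr : identically_distributed (fun n : nat => Y n.+1) mu.
Hypothesis mu_ge0 : mu `]-oo, 0%R[%classic = 0.
Hypothesis mu_not0 : mu [set 0%R] != 1.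
Local Notation leb := (@lebesgue_measure R).
Local Notation C := (state_space mu).

Let mC : measurable (C : set (RR R)) := measurable_state_space mu.

Lemma measure_state_spaceI (m : {measure set (RR R) -> \bar R}) (A : set (RR R)) :
  m (~` C) = 0 -> measurable A -> m (A `&` C) = m A.
Proof.
move=> mC0 mA; rewrite -[in RHS](setIT A) -(setUv (C : set (RR R))) setIUr measureU//.
- rewrite [X in _ + X](_ : _ = 0) ?adde0//.
  apply: (subset_measure0 _ _ _ mC0) => //.
    by apply: measurableI => //; exact: measurableC.
  exact: measurableC.
- exact: measurableI.
- by apply: measurableI => //; exact: measurableC.
- by rewrite setIACA setICr setI0.
Qed.

Lemma rho_off_state_space : rho mu (~` C) = 0.
Proof. by rewrite /= /rho setICl integral_set0. Qed.

Lemma overshoot_le1 (v : RR R) (A : set (RR R)) : measurable A -> overshoot mu v A <= 1.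
Proof. by move=> mA; apply: probability_le1; exact: measurable_image_event. Qed.

(** A cycle of the reflection process started from [rho] consists of descents,
    whose occupation measure is [nu] by [green_rho], and of one overshoot, which
    sends [nu] back to [rho].  If [rho] were zero, then so would be [nu]. *)
Lemma rho_reflections_invariant :
  invariant_measure C (reflections_transition Y) (rho mu).
Proof.
split; first exact: rho_off_state_space.
  apply/negP => /eqP rhoC.
  have rhoT : rho mu setT = 0.
    by rewrite -(measure_state_spaceI rho_off_state_space measurableT) setTI.
  have mc : measurable_fun setT (fun x : RR R => (cst 1%R x : R)%:E).
    exact/measurable_EFinP/measurable_cst.
  have nu1 : \int[nu mu]_x (cst 1%R x : R)%:E = nu mu setT.
    by rewrite -[RHS]mul1e -(integral_cst _ measurableT).
  have := @green_rho R mu mu_ge0 mu_not0 (cst 1%R) (fun=> ler01) (measurable_cst _).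
  rewrite nu1 eseries0; last first.
    move=> n _ _; rewrite integral_killed//.
    apply: null_set_integral => //; apply: measurable_iter_descent_op => //; exact: mc.
  by move=> n0; have := nu_gt0 mu_ge0 mu_not0; rewrite -n0 eqxx.
move=> A mA AC.
have mov := measurable_kernel (overshoot mu) A mA.
have ovE v : overshoot mu v A = (fine (overshoot mu v A))%:E.
  by rewrite fineK// ge0_fin_numE// (le_lt_trans (overshoot_le1 v mA))// ltry.
transitivity (\int[rho mu]_x reflections_transition Y x A).
  apply: (ge0_integral_full mC rho_off_state_space).
    by move=> x; exact: reflections_transition_ge0.
  exact: (measurable_reflections_transition Yindep Ydistr).
transitivity (\int[nu mu]_v overshoot mu v A); last exact: overshoot_nu.
rewrite (integral_reflections_transition Yindep Ydistr)//.
transitivity (\int[nu mu]_v (fine (overshoot mu v A))%:E); last first.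
  by apply: eq_integral => v _; rewrite -ovE.
rewrite -green_rho//.
- by apply: eq_eseriesr => n _; apply: eq_integral => v _; rewrite -ovE.
- exact: measurableT_comp.
Qed.

Section uniqueness.
Context (m' : {measure set (RR R) -> \bar R}).
Hypothesis m'inv : invariant_measure C (reflections_transition Y) m'.
Hypothesis m'radon : radon_measure C m'.

(** The mean time spent in a set between two reflections, when [m'] is the
    distribution just after the first one. *)
Definition occupation : {measure set (RR R) -> \bar R} :=
  mseries (killed mu m') 0.
Local Notation m := occupation.

Let mE A : m A = \sum_(n <oo) killed mu m' n A.
Proof. by []. Qed.

Let integral_m (f : RR R -> \bar R) : (forall x, 0 <= f x) -> measurable_fun setT f ->
  \int[m]_x f x = \sum_(n <oo) \int[killed mu m' n]_x f x.
Proof. by move=> f0 mf; rewrite /occupation ge0_integral_measure_series. Qed.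

Lemma descent_off_state_space (v : RR R) : C v -> descent mu v (~` C) = 0.
Proof.
move=> [v0 vN]; apply: (subset_measure0 _ _ _ mu_ge0) => //.
  by apply: measurable_image_event; exact: measurableC.
move=> y /= [vy nC]; rewrite in_itv/= ltNge; apply/negP => y0; apply: nC.
split; first exact: ltW.
by rewrite (le_trans _ vN)// lee_fin /increment/= gerBl.
Qed.

Lemma killed_off_state_space n : killed mu m' n (~` C) = 0.
Proof.
elim: n => [|n IH]; first by case: m'inv.
transitivity (\int[killed mu m' n]_(x in C) descent mu x (~` C)).
  apply/esym/(ge0_integral_full mC IH) => //.
  by apply: measurable_kernel; exact: measurableC.
by apply: integral0_eq => v Cv; exact: descent_off_state_space.
Qed.

Lemma occupation_off_state_space : m (~` C) = 0.
Proof. by rewrite mE eseries0// => n _ _; exact: killed_off_state_space. Qed.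

(** The next reflection comes from an overshoot after some number of descents,
    so that this is the invariance of [m'] under the reflection process. *)
Lemma overshoot_occupation (A : set (RR R)) : measurable A -> A `<=` C ->
  \int[m]_x overshoot mu x A = m' A.
Proof.
move=> mA AC; have [m'C0 _ m'I] := m'inv.
rewrite integral_m//; last exact: measurable_kernel.
rewrite -(integral_reflections_transition Yindep Ydistr)// -m'I//.
apply/esym/(ge0_integral_full mC m'C0).
  by move=> x; exact: reflections_transition_ge0.
exact: (measurable_reflections_transition Yindep Ydistr).
Qed.

(** A reflecting step sends the occupation measure to [m'], which is its term of
    index 0, and a descent produces the terms of positive index. *)
Lemma occupation_invariant : invariant_measure C (walk_transition Y) m.
Proof.
have [m'C0 m'C m'I] := m'inv.
split; first exact: occupation_off_state_space.
  rewrite gt_eqF// (@lt_le_trans _ _ (m' C))//; first by rewrite lt0e m'C measure_ge0.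
  rewrite mE; have := @nneseries_lim_ge R (fun n => killed mu m' n C) xpredT 0 1.
  by rewrite big_nat1/=; apply.
move=> A mA AC.
have md := measurable_kernel (descent mu) A mA.
have mo := measurable_kernel (overshoot mu) A mA.
transitivity (\int[m]_x (descent mu x A + overshoot mu x A)).
  rewrite -(ge0_integral_full mC occupation_off_state_space).
  - by apply: eq_integral => x _; exact: walk_transitionE.
  - by move=> x; exact: adde_ge0.
  - exact: emeasurable_funD.
rewrite ge0_integralD// overshoot_occupation// integral_m//.
rewrite addeC mE [in RHS](@nneseries_split _ _ 0 1)// add0n big_nat1; congr (_ + _).
by rewrite -nneseries_addn//; apply: eq_eseriesr => n _; rewrite addn1.
Qed.

(** A descent from [x] multiplies the exponential function by at most [q < 1],
    because [exp (x - y) = exp x * exp (- y)].  Hence the terms of the occupation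
    measure decrease geometrically; the first one is finite since the state
    space is compact. *)
Lemma occupation_finite (N : R) : supN mu = N%:E -> m setT < +oo.
Proof.
move=> NE; have [m'C0 _ _] := m'inv.
have CE : C = `[0%R, N]%classic.
  by apply/seteqP; split => x /=; rewrite /state_space/= NE lee_fin in_itv/= => /andP.
have m'C : m' C < +oo.
  by apply: m'radon => //; rewrite CE; exact: segment_compact.
have [q [q0 q1 lap]] := laplace_lt1 mu_ge0 mu_not0.
pose V (x : RR R) : \bar R := (expR x)%:E.
have V0 x : 0 <= V x by rewrite lee_fin expR_ge0.
have mV : measurable_fun setT V by exact/measurable_EFinP.
have descV x : descent_op mu V x <= q%:E * V x.
  have mexp := @measurable_expN_nneg R.
  have mW : measurable_fun setT
      (fun y : RR R => if above (x, y) then V (increment (x, y)) else 0).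
    apply: measurable_fun_ifT => //.
      exact: (measurable_fun_pair2 _ (@measurable_above R)).
    apply: (measurableT_comp mV).
    exact: (measurable_fun_pair2 _ (@measurable_increment R)).
  rewrite muleC; apply: (@le_trans _ _ (V x * \int[mu]_y
      (if (0 <= y)%R then (expR (- y))%:E else 0))); last by apply: lee_wpmul2l.
  rewrite -ge0_integralZl//; last by move=> y _; case: ifP; rewrite // lee_fin expR_ge0.
  rewrite /descent_op integral_image_kernel// integral_mu_nneg//; last first.
    by move=> y; case: ifP.
  apply: ge0_le_integral => //.
  - by move=> y _; case: ifP => // _; case: ifP.
  - by apply: measurable_fun_ifT => //; exact: measurable_fun_ler.
  - exact: measurable_funeM.
  - move=> y _; case: ifP => y0; last by rewrite mule0.
    case: ifP => _; last by rewrite mule_ge0// lee_fin expR_ge0.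
    by rewrite /V /increment/= -EFinM lee_fin expRD.
have iterV n x : iter n (descent_op mu) V x <= (q ^+ n)%:E * V x.
  elim: n x => [|n IH] x; first by rewrite expr0 mul1e.
  rewrite iterS (@le_trans _ _ (\int[descent mu x]_u ((q ^+ n)%:E * V u)))//.
    apply: ge0_le_integral => //.
    - by move=> u _; exact: iter_descent_op_ge0.
    - exact: measurable_iter_descent_op.
    - exact: measurable_funeM.
  rewrite ge0_integralZl//; last by rewrite lee_fin exprn_ge0.
  rewrite exprSr EFinM -muleA; apply: lee_wpmul2l; first by rewrite lee_fin exprn_ge0.
  exact: descV.
pose K := fine (\int[m']_x V x).
have KE : \int[m']_x V x = K%:E.
  rewrite fineK// ge0_fin_numE; last exact: integral_ge0.
  rewrite -(ge0_integral_full mC m'C0)//.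
  rewrite (@le_lt_trans _ _ (\int[m']_(x in C) (cst (expR N)%:E x)))//.
    apply: ge0_le_integral => //; first exact: measurable_funTS.
    move=> x [_]; rewrite NE lee_fin => xN.
    by rewrite lee_fin ler_expR.
  by rewrite integral_cst// lte_mul_pinfty.
have K0 : (0 <= K)%R by apply: fine_ge0; exact: integral_ge0.
(* the exponential is at least 1 on the state space *)
have bound n : killed mu m' n setT <= (q ^+ n * K)%:E.
  rewrite -(measure_state_spaceI (killed_off_state_space n) measurableT) setTI.
  rewrite -[leLHS]mul1e -(integral_cst _ mC) EFinM -KE.
  apply: (@le_trans _ _ (\int[killed mu m' n]_x V x)).
    apply: (@le_trans _ _ (\int[killed mu m' n]_(x in C) V x)).
      apply: ge0_le_integral => //; first exact: measurable_funTS.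
      by move=> x [x0 _]; rewrite lee_fin -expR0 ler_expR.
    by rewrite (ge0_integral_full mC (killed_off_state_space n)).
  rewrite integral_killed// -ge0_integralZl//; last by rewrite lee_fin exprn_ge0.
  apply: ge0_le_integral => //.
  - by move=> x _; exact: iter_descent_op_ge0.
  - exact: measurable_iter_descent_op.
  - exact: measurable_funeM.
rewrite mE (@le_lt_trans _ _ (K / (1 - q))%:E)//; last exact: ltry.
apply: lime_le; first exact: is_cvg_nneseries.
apply: nearW => n; apply: (@le_trans _ _ (\sum_(0 <= k < n) (q ^+ k * K)%:E)).
  by apply: lee_sum.
rewrite sumEFin lee_fin.
have -> : (\sum_(0 <= k < n) q ^+ k * K = series (geometric K q) n)%R.
  by rewrite /series/=; apply: eq_bigr => k _; rewrite mulrC.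
rewrite geometric_seriesE ?lt_eqF//=; apply: ler_wpM2r.
  by rewrite invr_ge0 subr_ge0 ltW.
by rewrite ler_piMr// gerBl exprn_ge0.
Qed.

(** As the support is unbounded, [a < Y <= b] has positive probability for some
    [b].  On this event a walk at a point between 0 and [a] is reflected to a
    point between 0 and [b].  Reflecting steps send the occupation measure to
    [m'], which is finite between 0 and [b]. *)
Lemma occupation_locally_finite (a : R) : (0 <= a)%R -> supN mu = +oo ->
  m `[0%R, a]%classic < +oo.
Proof.
move=> a0 NE.
have C0 x : (0 <= x)%R -> C x by move=> x0; split => //; rewrite NE leey.
have [z [sz az]] : exists z, supp mu z /\ (a < z)%R.
  apply: contrapT => /forallNP h; suff : supN mu <= a%:E by rewrite NE.
  apply: ge_ereal_sup => _ [z sz <-]; rewrite lee_fin leNgt.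
  by apply/negP => az; apply: (h z).
have ta : 0 < tail mu a.
  by apply: sz; [exact: interval_open|rewrite /= in_itv/= andbT].
have ta' : (0 < fine (tail mu a))%R.
  by rewrite fine_gt0// ta ltey_eq tail_fin_num.
have ta2 : (0 < fine (tail mu a) / 2)%R by rewrite divr_gt0.
have [b tb] := tail_small mu ta2.
have tba : tail mu b < tail mu a.
  rewrite (le_lt_trans tb)// -[ltRHS]fineK ?tail_fin_num// lte_fin.
  by rewrite ltr_pdivrMr// mulr_natr mulr2n ltrDl.
have ab : (a <= b)%R.
  rewrite leNgt; apply/negP => ba; move: tba; rewrite ltNge => /negP; apply.
  by apply: le_measure; rewrite ?inE//; apply: subset_itvr; rewrite bnd_simp ltW.
pose e := mu `]a, b]%classic.
have e0 : 0 < e.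
  rewrite lt0e measure_ge0 andbT; apply/eqP => e0; move: tba.
  have -> : tail mu a = e + tail mu b.
    rewrite /e /tail -measureU//=; first by rewrite -itv_bndbnd_setU// bnd_simp.
    by apply/seteqP; split => y //=; rewrite !in_itv/= andbT => -[/andP[_ yb]];
      rewrite ltNge yb.
  by rewrite e0 add0e ltxx.
have b0 : (0 <= b)%R := le_trans a0 ab.
have m'b : m' `[0%R, b]%classic < +oo.
  apply: m'radon; first exact: segment_compact.
  by move=> x /=; rewrite in_itv/= => /andP[x0 _]; exact: C0.
rewrite ltNge leye_eq; apply/eqP => ma.
suff : e * +oo <= m' `[0%R, b]%classic.
  by rewrite gt0_muley// leye_eq => /eqP E; rewrite E in m'b.
rewrite -ma -overshoot_occupation//; last first.
  by move=> x /=; rewrite in_itv/= => /andP[x0 _]; exact: C0.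
rewrite -(integral_cst m)//.
have mov : measurable_fun setT (fun x => overshoot mu x `[0%R, b]%classic).
  exact: measurable_kernel.
apply: (@le_trans _ _ (\int[m]_(x in `[0%R, a]) overshoot mu x `[0%R, b]%classic)).
  apply: ge0_le_integral => //.
  - exact: measurable_funTS.
  - move=> x /=; rewrite in_itv/= => /andP[x0 xa].
    apply: le_measure; rewrite ?inE//; first exact: measurable_image_event.
    move=> y /=; rewrite !in_itv/= /crosses /excess/= => /andP[ay yb].
    have xy := le_trans xa (ltW ay).
    by rewrite subr_le0 subr_ge0 xy lerBlDr (le_trans yb)// lerDl.
exact: ge0_subset_integral.
Qed.

Lemma occupation_radon : radon_measure C m.
Proof.
move=> K cK KC.
have mK : measurable (K : set (RR R)).
  by apply: closed_measurable; exact: compact_closed.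
have := supN_gtNy mu; case NE : (supN mu) => [N| |] // _.
  rewrite (@le_lt_trans _ _ (m setT))//; first by apply: le_measure; rewrite ?inE.
  exact: (occupation_finite NE).
have [M [Mr KM]] := compact_bounded cK.
pose a := (Num.max 0 M + 1)%R.
have a0 : (0 <= a)%R by rewrite addr_ge0// le_max lexx.
rewrite (@le_lt_trans _ _ (m `[0%R, a]%classic))//; last exact: occupation_locally_finite.
apply: le_measure; rewrite ?inE//.
move=> x Kx /=; rewrite in_itv/=; apply/andP; split; first by have [] := KC x Kx.
apply: (le_trans (ler_norm x)); apply: KM => //.
by rewrite /a ltr_pwDr// le_max lexx orbT.
Qed.

End uniqueness.

End invariance_and_occupation.

(** * Uniqueness *)

Section uniqueness_of_rho.
Local Open Scope ereal_scope.
Context d (T : measurableType d) (R : realType) (P : probability T R).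
Context (Y : nat -> {RV P >-> R}) (mu : probability (RR R) R).
Hypothesis Yindep : mutually_independent (fun n : nat => Y n.+1).
Hypothesis Ydistr : identically_distributed (fun n : nat => Y n.+1) mu.
Hypothesis mu_ge0 : mu `]-oo, 0%R[%classic = 0.
Hypothesis mu_not0 : mu [set 0%R] != 1.
Local Notation leb := (@lebesgue_measure R).
Local Notation C := (state_space mu).

(** The density of [rho] is at most 1. *)
Lemma rho_radon : radon_measure C (rho mu).
Proof.
move=> K cK KC.
have mK : measurable (K : set (RR R)).
  by apply: closed_measurable; exact: compact_closed.
have mC : measurable (C : set (RR R)) := measurable_state_space mu.
have [M [Mr KM]] := compact_bounded cK.
pose a := (Num.max 0 M + 1)%R.
have a0 : (0 <= a)%R by rewrite addr_ge0// le_max lexx.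
apply: (@le_lt_trans _ _ (\int[leb]_(x in `[(- a)%R, a]) cst 1 x)); last first.
  rewrite integral_cst// mul1e /= lebesgue_measure_itv/=.
  by case: ifP => _; rewrite -?EFinB ltry.
rewrite /= /rho; apply: (@le_trans _ _ (\int[leb]_(x in K `&` C) cst 1 x)).
  apply: ge0_le_integral => //; first exact: measurableI.
  - by move=> x _; exact: rho_density_ge0.
  - by apply: measurable_rho_density; exact: measurableI.
  - by move=> x _; rewrite (le_trans (overlap_le_tail mu_ge0 x))// tail_le1.
apply: ge0_subset_integral => //; first exact: measurableI.
move=> x [Kx _] /=; rewrite in_itv/= -ler_norml; apply: KM => //.
by rewrite /a ltr_pwDr// le_max lexx orbT.
Qed.

(** An invariant Radon measure [m'] of the reflections is recovered from its
    occupation measure by one reflecting step.  The occupation measure being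
    invariant and Radon for the walk, it is a multiple of [nu], and a reflecting
    step sends [nu] to [rho]. *)
Lemma unique_rho :
  unique_invariant_radon_measure C (walk_transition Y) (nu mu) ->
  unique_invariant_radon_measure C (reflections_transition Y) (rho mu).
Proof.
move=> [_ _ nu_unique]; split.
- exact: rho_reflections_invariant.
- exact: rho_radon.
move=> m' m'inv m'radon.
have mC : measurable (C : set (RR R)) := measurable_state_space mu.
have [m'C0 _ _] := m'inv.
have [c c0 mE] := nu_unique _
  (occupation_invariant Yindep Ydistr mu_ge0 m'inv)
  (occupation_radon Yindep Ydistr mu_ge0 mu_not0 m'inv m'radon).
exists c => // A mA.
rewrite -(measure_state_spaceI m'C0 mA) -(measure_state_spaceI (rho_off_state_space mu) mA).
have mAC : measurable (A `&` C) by exact: measurableI.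
rewrite -(overshoot_occupation Yindep Ydistr m'inv mAC (@subIsetr _ _ _)).
have c0' : (0 <= c)%R := ltW c0.
rewrite (eq_measure_integral (mscale (NngNum c0') (nu mu))); last first.
  by move=> D mD _; rewrite mE.
rewrite ge0_integral_mscale//; last exact: measurable_kernel.
by congr (_ * _); exact: overshoot_nu.
Qed.

End uniqueness_of_rho.

Theorem mainTheorem4 (R : realType) (d : measure_display) (T : measurableType d)
    (P : probability T R) (Y : nat -> {RV P >-> R})
    (mu : probability (measurableTypeR R) R)
    (Yindep : mutually_independent (fun n : nat => Y n.+1))
    (Ydistr : identically_distributed (fun n : nat => Y n.+1) mu)
    (Yge0 : mu `]-oo, 0[%classic = 0%E)
    (Ynonconst : forall c : R, mu [set c] != 1%E)
    (nonlat : non_lattice mu) :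
  invariant_measure (state_space mu) (reflections_transition Y) (rho mu) /\
  (unique_invariant_radon_measure (state_space mu) (walk_transition Y) (nu mu) ->
   unique_invariant_radon_measure (state_space mu) (reflections_transition Y)
     (rho mu)).
Proof.
have mu_not0 : mu [set 0] != 1%E := Ynonconst 0.
split; first exact: rho_reflections_invariant.
exact: unique_rho.
Qed.
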